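(* Let $f=\{f(m)\}_{m\in\mathbb{Z}}$ be a sequence such that $\sum_{m\in\mathbb{Z}}\frac{|f(m)|}{\sqrt{1+|m|}}<\infty$. Define $$u_f(n,t)=\int_0^\infty p_u(f)(n)\,\frac{e^{-\frac{t^2}{4u}}}{u}\,du,\qquad n\in\mathbb{Z},\ t>0,$$ where $p_u(f)(n)=\sum_{m\in\mathbb{Z}}p_u(n-m)f(m)$, $n\in\mathbb{Z}$, $u>0$. Then: (i) $\lim_{t\to\infty}u_f(n,t)=0$ for every $n\in\mathbb{Z}$. (ii) $\big(\partial_t^2+\frac1t\partial_t+\Delta_d\big)u_f(n,t)=0$ for every $n\in\mathbb{Z}$ and $t>0$. (iii) $\lim_{t\to0^+}t\,\partial_tu_f(n,t)=-2f(n)$ for every $n\in\mathbb{Z}$. (iv) $\lim_{t\to0^+}\dfrac{u_f(n,t)}{\log t}=-2f(n)$ for every $n\in\mathbb{Z}$. (v) For every $n\in\mathbb{Z}$, $$(\log(-\Delta_d)f)(n)=-\lim_{t\to0^+}\big(u_f(n,t)+2f(n)\log t\big)+f(n)K,$$ where $$K=-\gamma+\int_{1/4}^\infty\frac{e^{-v}}{v}\,dv-\int_0^{1/4}\frac{1-e^{-v}}{v}\,dv$$ and $\gamma$ is the Euler–Mascheroni constant.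
   Context: The discrete Laplacian on $\mathbb{Z}$ is $(\Delta_dg)(n)=g(n+1)-2g(n)+g(n-1)$, $n\in\mathbb{Z}$; in (ii) it acts on the variable $n$. The associated heat kernel is $p_t(m)=e^{-2t}I_{|m|}(2t)$, $m\in\mathbb{Z}$, $t>0$, where $I_\nu$ is the modified Bessel function of the first kind of order $\nu$. For a sequence $f$ with $\sum_{m\in\mathbb{Z}}\frac{|f(m)|}{\sqrt{1+|m|}}<\infty$, the logarithmic discrete Laplacian is defined by $$(\log(-\Delta_d)f)(n)=\sum_{m\in\mathbb{Z},\,m\ne n}W_0(n-m)\,(f(n)-f(m))-\sum_{m\in\mathbb{Z}}W_\infty(n-m)f(m)-\gamma f(n),\qquad n\in\mathbb{Z},$$ where $\gamma$ is the Euler–Mascheroni constant, $W_0(m)=\int_0^1\frac{p_t(m)}{t}\,dt$ (used only for $m\neq0$) and $W_\infty(m)=\int_1^\infty\frac{p_t(m)}{t}\,dt$. *)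

(* Defs.v *)
From mathcomp Require Import all_boot all_order all_algebra.
From mathcomp Require Import all_classical all_reals all_analysis.
Import Order.TTheory GRing.Theory Num.Theory.
Import numFieldNormedType.Exports.

Set Implicit Arguments.
Unset Strict Implicit.
Unset Printing Implicit Defensive.

Local Open Scope classical_set_scope.
Local Open Scope ring_scope.

Section Defs.
Variable R : realType.
Implicit Types (a f g : int -> R) (D : set int) (m n : int) (t u x : R).

Local Notation mu := (@lebesgue_measure R).

(* Sum of an absolutely summable family, i.e. the Lebesgue integral over D for
   the counting measure; [\esum] itself is only meant for nonnegative terms.
   The value is meaningful only when [summable D (EFin \o a)]. *)
Definition zsum D a : R :=
  fine (esum D (EFin \o a)^\+ - esum D (EFin \o a)^\-)%E.

Definition discrete_laplacian g n : R := g (n + 1) - 2 * g n + g (n - 1).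

(* Power series of the modified Bessel function of the first kind; at natural
   orders, Gamma (j + k + 1) is the factorial of j + k. *)
Definition besselI (k : nat) x : R :=
  limn (series (fun j : nat => (x / 2) ^+ (2 * j + k) / (j`! * (j + k)`!)%:R)).

Definition heat_kernel t m : R := expR (- (2 * t)) * besselI `|m|%N (2 * t).

Definition heat_semigroup u f n : R :=
  zsum [set: int] (fun m => heat_kernel u (n - m) * f m).

Definition euler_gamma : R :=
  limn (fun N : nat => \sum_(1 <= k < N.+1) (k%:R)^-1 - ln N%:R).

Definition W0 m : R := \int[mu]_(t in `]0, 1[) (heat_kernel t m / t).

Definition Winf m : R := \int[mu]_(t in `]1, +oo[) (heat_kernel t m / t).

Definition log_laplacian f n : R :=
  zsum [set m | m != n] (fun m => W0 (n - m) * (f n - f m))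
  - zsum [set: int] (fun m => Winf (n - m) * f m)
  - euler_gamma * f n.

Definition weighted_summable f :=
  summable [set: int] (fun m => (`|f m| / Num.sqrt (1 + `|m|%:~R))%:E).

Definition extension_integrand f n t u : R :=
  heat_semigroup u f n * (expR (- (t ^+ 2 / (4 * u))) / u).

Definition extension f n t : R :=
  \int[mu]_(u in `]0, +oo[) extension_integrand f n t u.

Definition constK : R :=
  - euler_gamma + \int[mu]_(v in `](4^-1 : R), +oo[) (expR (- v) / v)
  - \int[mu]_(v in `]0, (4^-1 : R)[) ((1 - expR (- v)) / v).

End Defs.

Arguments euler_gamma {R}.
Arguments constK {R}.

(* Main.v *)
(** Write [u_f(n, t)] as the integral of [F(u) e^(-t^2/4u) / u], where
    [F(u) = p_u(f)(n)].  Everything follows from three facts about [F] on the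
    half-line: [F] is [O((1 + u)^(-1/4))], [F(u) - f(n)] is [O(u)], and the
    kernel solves the heat equation.  The limits are dominated convergence, and
    (ii) is an integration by parts in [u], because the Bessel operator in [t]
    acts on [e^(-t^2/4u) / u] as [d/du].

    The kernel bounds avoid asymptotics of Bessel functions.  The recurrence
    [k p_u(k) = u (p_u(k - 1) - p_u(k + 1))] shows that [p_u] decreases along
    each parity class, so total mass one gives [k p_u(k) <= 1]; telescoping its
    first two moments gives [p_u(k) <= 4 / sqrt u], and the two bounds together
    give the decay against the weight [1 / sqrt (1 + |m|)].

    In (v) the Euler constant cancels.  What remains is the small-time behaviour
    of the integral of [e^(-t^2/4u) / u] over (0, 1), computed from the
    antiderivative [ln x - Ein x] of [e^(-x) / x]. *)
Require Import Defs.
From mathcomp Require Import all_boot all_order all_algebra.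
From mathcomp Require Import all_classical all_reals all_analysis.
From mathcomp Require Import measurable_realfun ring lra zify.
Import Order.TTheory GRing.Theory Num.Theory.
Import numFieldNormedType.Exports.

Set Implicit Arguments.
Unset Strict Implicit.
Unset Printing Implicit Defensive.

Local Open Scope classical_set_scope.
Local Open Scope ring_scope.

(** * The heat kernel *)

Section BesselSeries.
Variable R : realType.
Implicit Types (k j N : nat) (z u : R).

(** The exponent 1/4 is an interpolation: p_u(k)^2 is at most a constant times (1/k) u^(-1/2), so
    p_u(k) = O(k^(-1/2) u^(-1/4)). The factor k^(-1/2) matches the summability hypothesis on f, and
    u^(-1/4) makes du/u integrable at infinity. Near u = 0, mass one gives F(u) - f(n) = sum of
    p_u(n-m) (f(m) - f(n)). Off the diagonal k^2 p_u(k) = O(u), and the square is what makes the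
    constant f(n) summable over m.

    Put w_k(u) = e^(-t^2/4u) / u^(k+1), and let W_k be its integral against F. Then d/dt sends W_k
    to -(t/2) W_(k+1). Hence t d/dt u_f is -2 times the integral of F against (t^2/4) w_1, a
    probability density concentrating at u = 0 as t tends to 0; this is (iii). For (ii) the
    integration by parts is done for each kernel p_u(n-m) and the result is summed against f. For
    (v) the logarithmic singularity is carried by f(n) times the integral of w_0 over (0, 1). Once
    it is subtracted, the integrals over (0, 1) and (1, oo) converge to the terms built from [W0]
    and [Winf]. Dividing the limit in (v) by log t gives (iv). *)

Definition bessel_coeff k j : R := ((j`! * (j + k)`!)%:R)^-1.

(** Removing the factor u^k from I_k(2u) leaves an entire function B_k of z = u^2, so that I_k(2u) =
    u^k B_k(u^2). In this form differentiation is an index shift, B_k' = B_(k+1), and u = 0 is an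
    ordinary point. *)
Definition bessel_entire k z : R := limn (pseries (bessel_coeff k) z).

Lemma bessel_coeff_ge0 k j : 0 <= bessel_coeff k j.
Proof. by rewrite invr_ge0. Qed.

Lemma is_cvg_bessel_entire k z : cvgn (pseries (bessel_coeff k) z).
Proof.
apply: (@is_cvg_pseries_inside _ _ (`|z| + 1)); last first.
  by rewrite [ltRHS]ger0_norm ?addr_ge0// ltrDl.
have z0 : 0 <= `|z| + 1 by rewrite addr_ge0.
(* The coefficients are at most 1 / j!, so the exponential series dominates. *)
apply: series_le_cvg (is_cvg_series_exp_coeff (`|z| + 1)) => [j|j|j].
- by rewrite mulr_ge0 ?bessel_coeff_ge0 ?exprn_ge0.
- by rewrite /exp_coeff /= divr_ge0 ?exprn_ge0.
- rewrite /exp_coeff /= mulrC ler_wpM2l ?exprn_ge0//.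
  rewrite lef_pV2 ?posrE ?ltr0n ?muln_gt0 ?fact_gt0// ler_nat.
  by rewrite leq_pmulr ?fact_gt0.
Qed.

Lemma pseries_diffs_bessel_coeff k :
  pseries_diffs (bessel_coeff k) = bessel_coeff k.+1.
Proof.
apply/funext => j; rewrite /pseries_diffs /bessel_coeff factS -mulnA natrM.
by rewrite invfM mulVKf ?pnatr_eq0// addSnnS.
Qed.

Global Instance is_derive_bessel_entire k z :
  is_derive z 1 (bessel_entire k) (bessel_entire k.+1 z).
Proof.
rewrite /bessel_entire -[in X in is_derive _ _ _ X]pseries_diffs_bessel_coeff.
apply: (@pseries_snd_diffs _ _ (`|z| + 1));
  rewrite ?pseries_diffs_bessel_coeff; try exact: is_cvg_bessel_entire.
by rewrite [ltRHS]ger0_norm ?addr_ge0// ltrDl.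
Qed.

Lemma bessel_entire_ge0 k z : 0 <= z -> 0 <= bessel_entire k z.
Proof.
move=> z0; apply: limr_ge; first exact: is_cvg_bessel_entire.
by apply: nearW => n; apply: sumr_ge0 => j _; rewrite mulr_ge0 ?bessel_coeff_ge0 ?exprn_ge0.
Qed.

(** The classical recurrence I_(k)(x) - I_(k+2)(x) = (2 (k+1) / x) I_(k+1)(x) at x = 2u, with the
    powers of u divided out. *)
Lemma bessel_entire_rec k z :
  z * bessel_entire k.+2 z + k.+1%:R * bessel_entire k.+1 z = bessel_entire k z.
Proof.
have coeff j : bessel_coeff k j.+1 =
    bessel_coeff k.+2 j + k.+1%:R * bessel_coeff k.+1 j.+1.
  rewrite /bessel_coeff !addSn !addnS !factS !natrM.
  have j0 : (j`!%:R : R) != 0 by rewrite pnatr_eq0 -lt0n fact_gt0.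
  have jk0 : ((j + k)`!%:R : R) != 0 by rewrite pnatr_eq0 -lt0n fact_gt0.
  have e i : (i.+1%:R : R) = i%:R + 1 by rewrite -natr1.
  have ne i : (i%:R + 1 : R) != 0 by rewrite natr1 pnatr_eq0.
  have ne2 : (j%:R + k%:R + 1 + 1 : R) != 0 by rewrite -natrD !natr1 pnatr_eq0.
  have ne1 : (j%:R + k%:R + 1 : R) != 0 by rewrite -natrD !natr1 pnatr_eq0.
  rewrite !e !natrD; field.
  by rewrite ?j0 ?jk0 ?ne2 ?ne1 ?ne.
(* The factor z raises the degree by one, so [n] terms of B_(k+2) match [n.+1] terms of the other
   two series. *)
have E n : pseries (bessel_coeff k) z n.+1 =
   z * pseries (bessel_coeff k.+2) z n + k.+1%:R * pseries (bessel_coeff k.+1) z n.+1.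
  rewrite /pseries /series /= !big_nat_recl//= !expr0 !mulr1.
  rewrite mulrDr addrCA; congr (_ + _).
    rewrite /bessel_coeff !add0n fact0 !mul1n factS natrM invfM mulrCA.
    by rewrite mulKf// pnatr_eq0.
  rewrite !mulr_sumr -big_split/=; apply: eq_bigr => j _.
  by rewrite coeff exprS; ring.
apply/esym/cvg_lim => //; rewrite -cvg_shiftS/=.
under eq_cvg do rewrite E.
apply: cvgD; apply: cvgMr.
  exact: is_cvg_bessel_entire.
have := @is_cvg_bessel_entire k.+1 z.
by rewrite -(cvg_shiftS (pseries (bessel_coeff k.+1) z)).
Qed.

Lemma bessel_entire0 : bessel_entire 0 0 = 1.
Proof.
apply/cvg_lim => //; rewrite -cvg_shiftS.
under eq_cvg.
  move=> n; rewrite /pseries /series /= big_nat_recl//= expr0 mulr1.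
  rewrite big1 => [|j _]; last by rewrite expr0n mulr0.
  rewrite addr0 /bessel_coeff fact0 mul1n invr1.
  over.
exact: cvg_cst.
Qed.

Definition heat_nat k u : R := expR (- (2 * u)) * (u ^+ k * bessel_entire k (u ^+ 2)).

Lemma heat_kernelE u m : heat_kernel u m = heat_nat `|m|%N u.
Proof.
rewrite /heat_kernel /heat_nat /besselI; congr (_ * _).
rewrite mulrAC divff ?pnatr_eq0// mul1r.
apply/cvg_lim => //.
rewrite (_ : series _ = (fun n => u ^+ `|m| * pseries (bessel_coeff `|m|) (u ^+ 2) n)).
  by apply: cvgMr; exact: is_cvg_bessel_entire.
apply/funext => n; rewrite /pseries /series /= mulr_sumr.
by apply: eq_bigr => j _; rewrite exprD exprM mulrAC mulrC; congr (_ * _); rewrite mulrC.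
Qed.

Lemma heat_nat_ge0 k u : 0 <= u -> 0 <= heat_nat k u.
Proof.
by move=> u0; rewrite !mulr_ge0 ?expR_ge0 ?exprn_ge0 ?bessel_entire_ge0 ?exprn_ge0.
Qed.

Lemma heat_nat_rec k u :
  k.+1%:R * heat_nat k.+1 u = u * (heat_nat k u - heat_nat k.+2 u).
Proof. by rewrite /heat_nat -(bessel_entire_rec k) !exprS expr0; ring. Qed.

Lemma heat_nat_at0 k : heat_nat k 0 = (k == 0)%N%:R.
Proof.
rewrite /heat_nat mulr0 oppr0 expR0 mul1r !expr0n /=.
by case: k => [|k]; rewrite ?mul0r// mul1r bessel_entire0.
Qed.

Lemma is_derive_heat_nat k u (c := k%:R * u ^+ k.-1 * bessel_entire k (u ^+ 2)
    + u ^+ k * (2 * u * bessel_entire k.+1 (u ^+ 2))) :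
  is_derive u 1 (heat_nat k) (expR (- (2 * u)) * c - 2 * heat_nat k u).
Proof.
have dX j : is_derive u 1 (fun u : R => u ^+ j) (j%:R * u ^+ j.-1).
  have := is_deriveX j (is_derive_id u 1).
  by rewrite exprfctE /GRing.scale/= mulr1.
have dB : is_derive u 1 (bessel_entire k \o (fun u : R => u ^+ 2))
    (2 * u * bessel_entire k.+1 (u ^+ 2)).
  apply: (is_derive_eq (is_derive1_comp (is_derive_bessel_entire _ _) (dX 2%N))).
  by rewrite mulrC.
have dE : is_derive u 1 (expR \o (fun u : R => - (2 * u))) (- 2 * expR (- (2 * u))).
  apply: (is_derive_eq (is_derive1_comp (is_derive_expR _)
    (is_deriveN (is_deriveZ 2 (is_derive_id u 1))))).
  by rewrite /GRing.scale/= mulrC mulr1.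
apply: (is_derive_eq (is_deriveM dE (is_deriveM (dX k) dB))).
by rewrite /c /heat_nat !fctE /GRing.scale/=; ring.
Qed.

(** The heat equation at the origin, where both neighbours have absolute value 1. *)
Global Instance is_derive_heat_nat0 u :
  is_derive u 1 (heat_nat 0) (2 * heat_nat 1 u - 2 * heat_nat 0 u).
Proof.
apply: (is_derive_eq (is_derive_heat_nat 0 u)).
by rewrite /heat_nat/= expr0 expr1; ring.
Qed.

Global Instance is_derive_heat_natS k u :
  is_derive u 1 (heat_nat k.+1) (heat_nat k.+2 u + heat_nat k u - 2 * heat_nat k.+1 u).
Proof.
apply: (is_derive_eq (is_derive_heat_nat k.+1 u)).
by rewrite /heat_nat/= -(bessel_entire_rec k) !exprS; ring.
Qed.

End BesselSeries.

(** * Mass, moments and decay of the heat kernel *)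

Section HeatKernelBounds.
Variable R : realType.
Implicit Types (k j N : nat) (z u : R).

Lemma continuous_heat_nat k : continuous (@heat_nat R k).
Proof.
move=> u; apply: differentiable_continuous; apply/derivable1_diffP.
by case: k => [|k]; exact: ex_derive.
Qed.

Lemma heat_nat_decr k u : 0 <= u -> heat_nat k.+2 u <= heat_nat k u.
Proof.
rewrite le_eqVlt => /predU1P[<-|u0]; first by rewrite !heat_nat_at0.
have := heat_nat_rec k u; rewrite -subr_ge0 -(pmulr_rge0 _ u0) => <-.
by rewrite mulr_ge0// heat_nat_ge0// ltW.
Qed.

(* The mass of the heat kernel on the integers from -N to N - 1. *)
Definition heat_mass N u : R := \sum_(0 <= k < N) (heat_nat k u + heat_nat k.+1 u).

Lemma heat_massS N u :
  heat_mass N.+1 u = heat_mass N u + (heat_nat N u + heat_nat N.+1 u).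
Proof. by rewrite /heat_mass big_nat_recr. Qed.

(** The discrete Laplacian telescopes over the block from -(N+1) to N. The flux p(N+1) - p(N)
    through the right end and p(N+2) - p(N+1) through the left end remain. *)
Lemma is_derive_heat_mass N u :
  is_derive u 1 (heat_mass N.+1) (heat_nat N.+2 u - heat_nat N u).
Proof.
elim: N => [|N IH].
  rewrite (_ : heat_mass 1 = heat_nat 0 + heat_nat 1).
    apply: (is_derive_eq (is_deriveD (is_derive_heat_nat0 u) (is_derive_heat_natS 0 u))).
    by ring.
  by apply/funext => x; rewrite /heat_mass big_nat1.
rewrite (_ : heat_mass N.+2 = heat_mass N.+1 + (heat_nat N.+1 + heat_nat N.+2)).
  apply: (is_derive_eq (is_deriveD IH
    (is_deriveD (is_derive_heat_natS N u) (is_derive_heat_natS N.+1 u)))).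
  by ring.
by apply/funext => x; rewrite heat_massS.
Qed.

Lemma heat_mass_at0 N : heat_mass N.+1 (0 : R) = 1.
Proof.
rewrite /heat_mass big_nat_recl// !heat_nat_at0 /= addr0 big1 ?addr0// => k _.
by rewrite !heat_nat_at0 addr0.
Qed.

(** At time 0 the mass is 1, so the mean value theorem turns the flux formula into an explicit
    defect. Its sign gives the bound by 1, and its size gives convergence to 1. *)
Lemma heat_mass_MVT N u : 0 <= u -> exists2 c, 0 <= c <= u &
  heat_mass N.+1 u = 1 + (heat_nat N.+2 c - heat_nat N c) * u.
Proof.
move=> u0.
have [| |c] := @MVT_segment R (heat_mass N.+1)
  (fun x => heat_nat N.+2 x - heat_nat N x) 0 u u0.
- by move=> x _; exact: is_derive_heat_mass.
- apply: continuous_in_subspaceT => x _.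
  apply: differentiable_continuous; apply/derivable1_diffP.
  exact: (@ex_derive _ _ _ _ _ _ _ (is_derive_heat_mass N x)).
- rewrite in_itv/= => cu; rewrite heat_mass_at0 subr0 => e.
  by exists c => //; rewrite -e addrC subrK.
Qed.

Lemma heat_mass_le1 N u : 0 <= u -> heat_mass N u <= 1.
Proof.
move=> u0; case: N => [|N]; first by rewrite /heat_mass big_nil.
have [c /andP[c0 _] ->] := heat_mass_MVT N u0.
by rewrite gerDl mulr_le0_ge0// subr_le0 heat_nat_decr.
Qed.

Lemma heat_nat_le1 k u : 0 <= u -> heat_nat k u <= 1.
Proof.
move=> u0; apply: le_trans (heat_mass_le1 k.+1 u0).
rewrite heat_massS addrCA lerDl addr_ge0 ?heat_nat_ge0//.
by apply: sumr_ge0 => j _; rewrite addr_ge0 ?heat_nat_ge0.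
Qed.

Lemma heat_natS_le k u : 0 <= u -> k.+1%:R * heat_nat k.+1 u <= u * heat_nat k u.
Proof.
by move=> u0; rewrite heat_nat_rec ler_wpM2l// gerBl heat_nat_ge0.
Qed.

Lemma cvg_heat_mass u : 0 <= u -> heat_mass N u @[N --> \oo] --> (1 : R).
Proof.
move=> u0.
rewrite -(cvg_shiftn 2).
(* The defect is at most u p_c(N+1) for some c in [0, u], and (N+1) p_c(N+1) <= c p_c(N) <= u. The
   shift by 2 makes N+1 the index at which this recurrence applies. *)
have lim1 : 1 - u ^+ 2 * harmonic N @[N --> \oo] --> (1 : R).
  rewrite -[X in _ --> X](_ : 1 - u ^+ 2 * 0 = 1); last by rewrite mulr0 subr0.
  by apply: cvgB; [exact: cvg_cst|apply: cvgMr; exact: cvg_harmonic].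
apply: (@squeeze_cvgr _ _ _ _ (fun N => 1 - u ^+ 2 * harmonic N) (fun=> 1)) => //; last exact: cvg_cst.
apply: nearW => N; rewrite /= addn2 heat_mass_le1// andbT.
have [c /andP[c0 cu] ->] := heat_mass_MVT N.+1 u0.
rewrite lerD2l expr2 mulrAC -mulNr ler_wpM2r//.
rewrite lerBrDr (le_trans _ (heat_nat_ge0 _ c0))//.
rewrite addrC subr_le0 ler_pdivlMr//.
rewrite mulrC (le_trans (heat_natS_le _ c0))//.
by rewrite (le_trans _ cu)// ler_piMr// heat_nat_le1.
Qed.

(* Same-parity terms up to N are all at least the N-th one. *)
Lemma heat_nat_mass k u : 0 <= u -> k%:R * heat_nat k u <= heat_mass k u.
Proof.
move=> u0; elim/ltn_ind: k => -[|[|k]] IH; first by rewrite mul0r /heat_mass big_nil.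
  by rewrite mul1r /heat_mass big_nat1 lerDr heat_nat_ge0.
have := IH k (leqW (leqnn _)).
rewrite !heat_massS -addn2 natrD addn2 mulrDl => IHk.
have := heat_nat_decr k u0.
have := @heat_nat_ge0 R k.+1 u u0.
have : k%:R * heat_nat k.+2 u <= k%:R * heat_nat k u.
  by rewrite ler_wpM2l// heat_nat_decr.
by lra.
Qed.

Lemma natr_heat_nat_le1 k u : 0 <= u -> k%:R * heat_nat k u <= 1.
Proof. by move=> u0; rewrite (le_trans (heat_nat_mass _ u0))// heat_mass_le1. Qed.

Lemma natrS_heat_nat_le2 k u : 0 <= u -> k.+1%:R * heat_nat k u <= 2.
Proof.
move=> u0; rewrite -natr1 mulrDl mul1r (_ : 2 = 1 + 1)//.
by rewrite lerD// ?heat_nat_le1// natr_heat_nat_le1.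
Qed.

(** By the recurrence each term is a difference across two sites, so the sum telescopes and leaves
    two terms at each end. *)
Lemma heat_nat_first_moment N u :
  \sum_(0 <= k < N) k.+1%:R * heat_nat k.+1 u =
  u * (heat_nat 0 u + heat_nat 1 u - heat_nat N u - heat_nat N.+1 u).
Proof.
elim: N => [|N IH]; first by rewrite big_nil; ring.
by rewrite big_nat_recr//= IH heat_nat_rec; ring.
Qed.

(** One use of the recurrence and a summation by parts exchange k^2 p(k) for terms of order zero. In
    the constant 3, the term p(1) accounts for 1, and each of the two remaining sums is at most the
    total mass. *)
Lemma heat_nat_second_moment N u : 0 <= u ->
  \sum_(0 <= k < N) k.+1%:R ^+ 2 * heat_nat k.+1 u <= 3 * u.
Proof.
move=> u0.
have -> : \sum_(0 <= k < N) k.+1%:R ^+ 2 * heat_nat k.+1 u =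
    u * (heat_nat 1 u - N%:R * heat_nat N u - N.+1%:R * heat_nat N.+1 u
    + \sum_(0 <= k < N) (heat_nat k u + heat_nat k.+2 u)).
  elim: N => [|N IH]; first by rewrite !big_nil; ring.
  rewrite !big_nat_recr//= IH expr2 -mulrA heat_nat_rec -!natr1; ring.
rewrite mulrC ler_wpM2r//.
have -> : 3 = 1 + 2 :> R by rewrite -(natrD _ 1 2).
apply: lerD.
  rewrite (le_trans _ (heat_nat_le1 1 u0))// -addrA gerDl -opprD oppr_le0.
  by rewrite addr_ge0// mulr_ge0// heat_nat_ge0.
rewrite big_split/= (_ : 2 = 1 + 1)// lerD//.
  rewrite (le_trans _ (heat_mass_le1 N u0))//; apply: ler_sum => k _.
  by rewrite lerDl heat_nat_ge0.
rewrite (le_trans _ (heat_mass_le1 N.+1 u0))//.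
rewrite /heat_mass big_nat_recl//=.
apply: ler_wpDl; first by rewrite addr_ge0 ?heat_nat_ge0.
by apply: ler_sum => k _; rewrite lerDr heat_nat_ge0.
Qed.

(* AM-GM turns the bound on the second moment into a bound on the first one. *)
Lemma sqrt_heat_nat01 u : 0 < u ->
  Num.sqrt u * (heat_nat 0 u + heat_nat 1 u) <= 4.
Proof.
move=> u0; have u0' := ltW u0; set s := Num.sqrt u.
have s0 : 0 < s by rewrite sqrtr_gt0.
have us : u = s * s by rewrite -expr2 sqr_sqrtr.
(* With N > sqrt u, the bound N p(N) <= 1 makes the upper boundary terms of the telescoped first
   moment at most sqrt u. *)
pose N := (Num.truncn s).+1.
have sN : s < N%:R by rewrite -truncn_le_nat.
have N0 : 0 < N%:R :> R by rewrite ltr0n.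
have tail k : (N <= k)%N -> u * heat_nat k u <= s.
  move=> Nk; have := natr_heat_nat_le1 k u0'.
  have : s * heat_nat k u <= k%:R * heat_nat k u.
    rewrite ler_wpM2r ?heat_nat_ge0//.
    by rewrite ltW// (lt_le_trans sN)// ler_nat.
  rewrite us -mulrA => /le_trans /[apply] h.
  by rewrite -[leRHS]mulr1 ler_wpM2l// ltW.
(* This is k <= (s + k^2 / s) / 2 with s = sqrt u, the scale at which both terms have the same
   order. With mass at most 1 and second moment at most 3 s^2, the first moment is at most 2 s. *)
have amgm k : k.+1%:R * heat_nat k.+1 u <=
    2^-1 * (s * heat_nat k.+1 u + s^-1 * (k.+1%:R ^+ 2 * heat_nat k.+1 u)).
  rewrite (mulrA s^-1) -mulrDl [in leRHS]mulrA ler_wpM2r ?heat_nat_ge0//.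
  rewrite ler_pdivlMl// -(ler_pM2r s0) [leRHS]mulrDl [X in _ + X]mulrAC mulVf ?gt_eqF// mul1r.
  by have := sqr_ge0 (s - k.+1%:R); rewrite !expr2; lra.
have first : u * (heat_nat 0 u + heat_nat 1 u - heat_nat N u - heat_nat N.+1 u)
    <= 2 * s.
  rewrite -heat_nat_first_moment.
  rewrite (le_trans (ler_sum _ (fun k _ => amgm k)))//.
  rewrite -mulr_sumr big_split/= -[X in X + _]mulr_sumr -[X in _ + X]mulr_sumr ler_pdivrMl//.
  have h2 : s^-1 * (\sum_(0 <= i < N) i.+1%:R ^+ 2 * heat_nat i.+1 u) <= 3 * s.
    rewrite ler_pdivrMl// mulrCA -us.
    exact: heat_nat_second_moment.
  have h1 : s * (\sum_(0 <= i < N) heat_nat i.+1 u) <= s.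
    rewrite -[leRHS]mulr1; apply: ler_wpM2l; first exact: ltW.
    rewrite (le_trans _ (heat_mass_le1 N u0'))//.
    by apply: ler_sum => k _; rewrite lerDr heat_nat_ge0.
  by rewrite (le_trans (lerD h1 h2))//; lra.
(* The constant 4 is 2 from the first moment and 1 from each of the two boundary terms. *)
have := tail N (leqnn _); have := tail N.+1 (leqnSn _).
move: first; rewrite -(ler_pM2l s0) us; nra.
Qed.

Lemma sqrt_heat_nat k u : 0 < u -> Num.sqrt u * heat_nat k u <= 4.
Proof.
move=> u0; have u0' := ltW u0.
have := sqrt_heat_nat01 u0; rewrite mulrDr.
have s0 j : 0 <= Num.sqrt u * heat_nat j u by rewrite mulr_ge0 ?sqrtr_ge0 ?heat_nat_ge0.
elim/ltn_ind: k => -[|[|k]] IH.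
- by have := s0 1%N; lra.
- by have := s0 0%N; lra.
- move=> /(IH k (leqW (leqnn _))); apply: le_trans.
  by rewrite ler_wpM2l ?sqrtr_ge0// heat_nat_decr.
Qed.

Definition decay u : R := (1 + u) `^ (- 4^-1).

Lemma decay_ge0 u : 0 <= decay u.
Proof. exact: powR_ge0. Qed.

Lemma heat_nat_decay k u : 0 < u ->
  Num.sqrt k.+1%:R * heat_nat k u <= 4 * decay u.
Proof.
move=> u0; have u0' := ltW u0; rewrite /decay.
have v0 : 0 < 1 + u by rewrite addr_gt0.
have s0 : 0 < Num.sqrt (1 + u) by rewrite sqrtr_gt0.
rewrite -(@ler_pXn2r _ 2)// ?nnegrE; last 2 first.
- by apply: mulr_ge0; [exact: sqrtr_ge0|exact: heat_nat_ge0].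
- by rewrite mulr_ge0 ?powR_ge0.
rewrite [leLHS]exprMn [leRHS]exprMn sqr_sqrtr//.
have -> : ((1 + u) `^ (- 4^-1)) ^+ 2 = (Num.sqrt (1 + u))^-1.
  rewrite -powR_mulrn ?powR_ge0// -powRrM -powR12_sqrt ?ltW// -powRN.
  by congr powR; lra.
rewrite ler_pdivlMr// [leLHS](_ : _ =
  (k.+1%:R * heat_nat k u) * (Num.sqrt (1 + u) * heat_nat k u)); last by ring.
have h0 := @heat_nat_ge0 R k u u0'.
have sD : Num.sqrt (1 + u) <= 1 + Num.sqrt u.
  rewrite -[leRHS]ger0_norm ?addr_ge0 ?sqrtr_ge0// -sqrtr_sqr ler_wsqrtr//.
  rewrite sqrrD sqr_sqrtr// expr1n mul1r lerD2r lerDl.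
  by rewrite mulrn_wge0// sqrtr_ge0.
(* After squaring, the factors are (k+1) p <= 2 and sqrt (1+u) p <= (1 + sqrt u) p <= 1 + 4; the
   constant 4 of the statement has square 16, above 10. *)
apply: (@le_trans _ _ (2 * 5)); last by rewrite -natrX -natrM ler_nat.
apply: ler_pM.
- by apply: mulr_ge0 => //; exact: heat_nat_ge0.
- by apply: mulr_ge0; [exact: sqrtr_ge0|exact: heat_nat_ge0].
- exact: natrS_heat_nat_le2.
rewrite (le_trans (ler_wpM2r h0 sD))// mulrDl mul1r.
rewrite (_ : 5 = 1 + 4); last by rewrite -(natrD _ 1 4).
by rewrite lerD// ?heat_nat_le1// sqrt_heat_nat.
Qed.

(** The recurrence gives (k+1) p(k+1) <= u p(k), and the remaining factor k+1 is absorbed by (k+1)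
    p(k) <= 2. Passing from k+1 to k+2, the weight 1 + |m| of this site, costs a factor 4. *)
Lemma heat_natS_small_time k u : 0 <= u -> k.+2%:R ^+ 2 * heat_nat k.+1 u <= 8 * u.
Proof.
move=> u0.
have h : k.+1%:R ^+ 2 * heat_nat k.+1 u <= 2 * u.
  rewrite expr2 -mulrA (le_trans (ler_wpM2l _ (heat_natS_le k u0)))//.
  by rewrite mulrCA mulrC ler_wpM2r// natrS_heat_nat_le2.
apply: (@le_trans _ _ (4 * (k.+1%:R ^+ 2 * heat_nat k.+1 u))); last first.
  by rewrite -[8]/((4 * 2)%N%:R) natrM -mulrA ler_wpM2l.
rewrite mulrA ler_wpM2r ?heat_nat_ge0//.
by rewrite -!natrX -natrM ler_nat -[4%N]/(2 ^ 2)%N -expnMn leq_exp2r//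
  mul2n -addnn addSn ltnS addnS ltnS leq_addl.
Qed.

End HeatKernelBounds.

(** * Sums over the integers and their integrals *)

Section IntegerSums.
Variable R : realType.
Implicit Types (a b c : int -> R) (m n : int).

Local Notation zsummable a := (summable [set: int] (EFin \o a)).

(* Folds a two-sided sequence: [Negz k] is [- (k + 1)]. *)
Definition fold_int a (k : nat) : R := a (Posz k) + a (Negz k).

Lemma esum_int (a : int -> \bar R) : (forall m, 0 <= a m)%E ->
  (\esum_(m in [set: int]) a m = \sum_(k <oo) (a (Posz k) + a (Negz k)))%E.
Proof.
move=> a0; rewrite (esumID (range Posz))// !setTI.
rewrite (_ : ~` range Posz = range Negz); last first.
  apply/seteqP; split => [[k|k] //= h|_ [k _ <-] [j _]//].
    by exfalso; apply: h; exists k.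
  by exists k.
rewrite (esum_image _ Posz) ?(esum_image _ Negz); [|by move=> i j _ _ []..].
by rewrite -!nneseries_esumT// -nneseriesD.
Qed.

Lemma cvg_fold_int_ge0 a : (forall m, 0 <= a m) -> zsummable a ->
  series (fold_int a) n @[n --> \oo] --> fine (esum [set: int] (EFin \o a)).
Proof.
move=> a0; rewrite /summable => sa.
have eS : esum [set: int] (EFin \o a) = esum [set: int] (fun m => `|(EFin \o a) m|%E).
  by apply: eq_esum => m _ /=; rewrite ger0_norm.
have Sfin : esum [set: int] (EFin \o a) \is a fin_num.
  by rewrite ge0_fin_numE ?eS// esum_ge0.
have : ((\sum_(0 <= k < n) ((a (Posz k))%:E + (a (Negz k))%:E))%E @[n --> \oo]
    --> (fine (esum [set: int] (EFin \o a)))%:E)%classic.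
  rewrite fineK// esum_int => [|m]; last by rewrite /= lee_fin.
  by apply: is_cvg_nneseries => k _ _; rewrite -EFinD lee_fin addr_ge0.
move=> /fine_cvgP[_]; apply: cvg_trans; apply: near_eq_cvg; apply: nearW => n /=.
by rewrite /series /fold_int /=; under eq_bigr do rewrite -EFinD; rewrite sumEFin.
Qed.

Lemma zsummable_le a b : (forall m, `|a m| <= b m) -> zsummable b -> zsummable a.
Proof.
move=> ab; apply: le_lt_trans; apply: le_esum => m _ /=.
by rewrite lee_fin (le_trans (ab m))// ler_norm.
Qed.

Lemma zsummable_norm a : zsummable a -> zsummable (Num.norm \o a).
Proof.
by apply: le_lt_trans; apply: le_esum => m _ /=; rewrite lee_fin normr_id.
Qed.

Lemma zsummable_bounded a (M : R) :
  (forall k, series (fold_int (Num.norm \o a)) k <= M) -> zsummable a.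
Proof.
move=> aM; rewrite /summable esum_int//.
apply: (@le_lt_trans _ _ M%:E); last exact: ltry.
apply: lime_le; first by apply: is_cvg_nneseries => k _ _; rewrite adde_ge0.
apply: nearW => k; under eq_bigr do rewrite -EFinD.
by rewrite sumEFin lee_fin aM.
Qed.

Lemma zsummableZ r a : zsummable a -> zsummable (fun m => r * a m).
Proof.
move=> /zsummable_norm/(cvg_fold_int_ge0 (fun m => normr_ge0 (a m))).
set S := fine _ => cS; apply: (@zsummable_bounded _ (`|r| * S)) => k.
rewrite (_ : series _ k = `|r| * series (fold_int (Num.norm \o a)) k).
  rewrite ler_wpM2l// -(cvg_lim _ cS)//.
  apply: nondecreasing_cvgn_le; last by apply/cvg_ex; exists S.
  by apply/nondecreasing_seqP => i; rewrite /series/= big_nat_recr//= lerDl addr_ge0/=.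
rewrite /series/= mulr_sumr; apply: eq_bigr => i _.
by rewrite /fold_int/= !normrM mulrDr.
Qed.

Lemma zsummableD a b : zsummable a -> zsummable b -> zsummable (fun m => a m + b m).
Proof. exact: summableD. Qed.

Lemma zsummableN a : zsummable a -> zsummable (fun m => - a m).
Proof. by move=> /zsummable_norm; apply: zsummable_le => m /=; rewrite normrN. Qed.

(** The bridge from the Lebesgue-style [zsum] to limits of finite sums. The algebra of [zsum] and
    its exchange with integrals are read off from the partial sums of the folded sequence. *)
Lemma cvg_zsum a : zsummable a -> series (fold_int a) n @[n --> \oo] --> zsum [set: int] a.
Proof.
move=> sa.
have sp : zsummable (fun m => Num.max (a m) 0).
  apply: zsummable_le (zsummable_norm sa) => m /=.
  rewrite ger0_norm ?le_max ?lexx ?orbT// ge_max ler_norm//=.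
have sn : zsummable (fun m => Num.max (- a m) 0).
  apply: zsummable_le (zsummable_norm sa) => m /=.
  by rewrite ger0_norm ?le_max ?lexx ?orbT// ge_max -normrN ler_norm/= normrN normr_ge0.
have p0 m : 0 <= Num.max (a m) 0 by rewrite le_max lexx orbT.
have n0 m : 0 <= Num.max (- a m) 0 by rewrite le_max lexx orbT.
have ep : esum [set: int] ((EFin \o a)^\+)%E = esum [set: int] (fun m => (Num.max (a m) 0)%:E).
  by apply: eq_esum => m _; rewrite funeposE/= EFin_max.
have en : esum [set: int] ((EFin \o a)^\-)%E = esum [set: int] (fun m => (Num.max (- a m) 0)%:E).
  by apply: eq_esum => m _; rewrite funenegE/= EFin_max EFinN.
have fin (c : int -> R) : (forall m, 0 <= c m) -> zsummable c ->
    esum [set: int] (EFin \o c) \is a fin_num.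
  move=> c0; rewrite /summable ge0_fin_numE; last by apply: esum_ge0 => m _; rewrite lee_fin.
  by apply: le_lt_trans; apply: le_esum => m _ /=; rewrite lee_fin ler_norm.
rewrite /zsum ep en fineB; [|exact: fin|exact: fin].
apply: cvg_trans; last exact: (cvgB (cvg_fold_int_ge0 p0 sp) (cvg_fold_int_ge0 n0 sn)).
apply: near_eq_cvg; apply: nearW => n /=.
rewrite !fctE /series /= -sumrB; apply: eq_bigr => k _; rewrite /fold_int.
have e x : Num.max x 0 - Num.max (- x) 0 = x :> R by rewrite !maxEle; case: ifP; case: ifP; lra.
by rewrite -[in RHS](e (a (Posz k))) -[in RHS](e (a (Negz k))); ring.
Qed.

Lemma zsumE a : zsummable a -> zsum [set: int] a = limn (series (fold_int a)).
Proof. by move=> sa; apply/esym/cvg_lim => //; exact: cvg_zsum. Qed.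

Lemma zsumZ r a : zsummable a -> zsum [set: int] (fun m => r * a m) = r * zsum [set: int] a.
Proof.
move=> sa; rewrite zsumE; last exact: zsummableZ.
apply/cvg_lim => //; rewrite (_ : series _ = fun k : nat => r * series (fold_int a) k).
  by apply: cvgMr; exact: cvg_zsum.
apply/funext => n; rewrite /series/= mulr_sumr.
by apply: eq_bigr => k _; rewrite /fold_int mulrDr.
Qed.

Lemma zsumD a b : zsummable a -> zsummable b ->
  zsum [set: int] (fun m => a m + b m) = zsum [set: int] a + zsum [set: int] b.
Proof.
move=> sa sb; rewrite zsumE; last exact: zsummableD.
apply/cvg_lim => //.
rewrite (_ : series _ = fun k : nat => series (fold_int a) k + series (fold_int b) k).
  by apply: cvgD; exact: cvg_zsum.
apply/funext => n; rewrite /series/= -big_split/=.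
by apply: eq_bigr => k _; rewrite /fold_int addrACA.
Qed.

Lemma zsumN a : zsummable a -> zsum [set: int] (fun m => - a m) = - zsum [set: int] a.
Proof.
move=> sa; rewrite -mulN1r -zsumZ//; congr zsum.
by apply/funext => m; rewrite mulN1r.
Qed.

Lemma ler_norm_zsum a b : (forall m, `|a m| <= b m) -> zsummable b ->
  forall k, `|series (fold_int a) k| <= zsum [set: int] b.
Proof.
move=> ab sb n.
have b0 m : 0 <= b m := le_trans (normr_ge0 _) (ab m).
rewrite (@le_trans _ _ (series (fold_int b) n))//.
  rewrite (le_trans (ler_norm_sum _ _ _))// ler_sum// => k _.
  by rewrite (le_trans (ler_normD _ _))// lerD.
rewrite zsumE//; apply: nondecreasing_cvgn_le; last by apply/cvg_ex; eexists; exact: cvg_zsum.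
by apply/nondecreasing_seqP => k; rewrite /series/= big_nat_recr//= lerDl addr_ge0.
Qed.

Lemma ler_zsum_norm a b : (forall m, `|a m| <= b m) -> zsummable b ->
  `|zsum [set: int] a| <= zsum [set: int] b.
Proof.
move=> ab sb; have sa := zsummable_le ab sb.
rewrite -(cvg_lim _ (cvg_norm (cvg_zsum sa)))//; apply: limr_le.
  by apply/cvg_ex; eexists; exact: cvg_norm (cvg_zsum sa).
by apply: nearW => n /=; exact: ler_norm_zsum.
Qed.

(** Replaces the punctured sum in [log_laplacian] by a sum over all integers, since its summand
    vanishes on the diagonal. *)
Lemma zsum_mkcond n a : a n = 0 -> zsum [set m | m != n] a = zsum [set: int] a.
Proof.
move=> an; rewrite /zsum; congr (fine (_ - _)%E).
  rewrite esum_mkcond; apply: eq_esum => m _.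
  by case: ifPn => //; rewrite notin_setE/= => /negP/negPn/eqP ->; rewrite funeposE/= an maxxx.
rewrite esum_mkcond; apply: eq_esum => m _.
by case: ifPn => //; rewrite notin_setE/= => /negP/negPn/eqP ->; rewrite funenegE/= an oppr0 maxxx.
Qed.

End IntegerSums.

Notation zsummable a := (summable [set: int] (EFin \o a)).

(** * Real-valued integrability and exchange of sum and integral *)

Section RealIntegrable.
Context d (T : measurableType d) (R : realType) (mu : {measure set T -> \bar R}).
Variable D : set T.

Lemma integrable_le (f g : T -> R) : measurable_fun D f ->
  (forall x, D x -> `|f x| <= g x) -> mu.-integrable D (EFin \o g) ->
  measurable D -> mu.-integrable D (EFin \o f).
Proof.
move=> mf fg ig mD; apply: le_integrable ig => //; first exact/measurable_EFinP.
by move=> x Dx /=; rewrite lee_fin (le_trans (fg _ Dx))// ler_norm.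
Qed.

Lemma integrable_mulr (r : R) (f : T -> R) : mu.-integrable D (EFin \o f) ->
  measurable D -> mu.-integrable D (EFin \o (fun x => r * f x)).
Proof. by move=> fi mD; exact: (integrableZl mD r fi). Qed.

Lemma integrable_add (f g : T -> R) : mu.-integrable D (EFin \o f) ->
  mu.-integrable D (EFin \o g) -> measurable D ->
  mu.-integrable D (EFin \o (fun x => f x + g x)).
Proof. by move=> fi gi mD; exact: (integrableD mD fi gi). Qed.

Lemma integrable_sub (f g : T -> R) : mu.-integrable D (EFin \o f) ->
  mu.-integrable D (EFin \o g) -> measurable D ->
  mu.-integrable D (EFin \o (fun x => f x - g x)).
Proof. by move=> fi gi mD; exact: (integrableB mD fi gi). Qed.

Lemma eq_integrable_fun (f g : T -> R) : (forall x, D x -> f x = g x) ->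
  mu.-integrable D (EFin \o f) -> measurable D -> mu.-integrable D (EFin \o g).
Proof.
by move=> fg fi mD; apply: eq_integrable fi => // x /set_mem Dx; rewrite /= fg.
Qed.

End RealIntegrable.

Section DominatedSums.
Context d (T : measurableType d) (R : realType) (mu : {measure set T -> \bar R}).
Variable D : set T.
Hypothesis mD : measurable D.

Lemma measurable_fun_limit (f_ : nat -> T -> R) (f : T -> R) :
  (forall n, measurable_fun D (f_ n)) ->
  (forall x, D x -> f_ n x @[n --> \oo] --> f x) -> measurable_fun D f.
Proof.
move=> mf_ ff; apply/measurable_EFinP.
apply: (emeasurable_fun_cvg (fun n => EFin \o f_ n)) => [n|x Dx].
  exact/measurable_EFinP.
by apply: cvg_EFin; [exact: nearW|exact: ff].
Qed.

Lemma measurable_zsum (h : int -> T -> R) : (forall m, measurable_fun D (h m)) ->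
  (forall x, D x -> zsummable (h ^~ x)) ->
  measurable_fun D (fun x => zsum [set: int] (h ^~ x)).
Proof.
move=> mh sh; apply: (@measurable_fun_limit (fun n x => series (fold_int (h ^~ x)) n)).
  by move=> n; apply: measurable_sum => k; exact: measurable_funD.
by move=> x Dx; apply: cvg_zsum; exact: sh.
Qed.

Lemma dominated_cvg_Rintegral (f_ : nat -> T -> R) (f g : T -> R) :
  (forall n, measurable_fun D (f_ n)) ->
  (forall x, D x -> f_ n x @[n --> \oo] --> f x) ->
  mu.-integrable D (EFin \o g) ->
  (forall n x, D x -> `|f_ n x| <= g x) ->
  mu.-integrable D (EFin \o f) /\
  \int[mu]_(x in D) f_ n x @[n --> \oo] --> \int[mu]_(x in D) f x.
Proof.
move=> mf_ ff ig fg.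
have mf : measurable_fun D f by exact: measurable_fun_limit ff.
have [||||i _ c] := @dominated_convergence _ _ _ mu D mD (fun n => EFin \o f_ n)
  (EFin \o f) (EFin \o g) _ _ _ ig _.
- by move=> n; exact/measurable_EFinP.
- exact/measurable_EFinP.
- apply: aeW => x Dx.
  by apply: cvg_EFin; [exact: nearW|exact: ff].
- by apply: aeW => x n Dx /=; rewrite lee_fin fg.
- by split => //; apply/fine_cvg; rewrite fineK//; exact: integrable_fin_num.
Qed.

Section Interchange.
Variables (h : int -> T -> R) (b : int -> R) (w : T -> R).
Hypothesis mh : forall m, measurable_fun D (h m).
Hypothesis sb : zsummable b.
Hypothesis iw : mu.-integrable D (EFin \o w).
Hypothesis hbw : forall m x, D x -> `|h m x| <= b m * w x.

Lemma integrable_summand m : mu.-integrable D (EFin \o h m).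
Proof.
by apply: (integrable_le (mh m) (hbw m)) => //; exact: integrable_mulr.
Qed.

Lemma zsummable_Rintegral : zsummable (fun m => \int[mu]_(x in D) h m x).
Proof.
apply: (zsummable_le (b := fun m => (\int[mu]_(x in D) `|w x|) * `|b m|)); last first.
  exact/zsummableZ/zsummable_norm.
move=> m; rewrite (le_trans (le_normr_Rintegral _ (integrable_summand m)))//.
rewrite mulrC -RintegralZl//; last exact: integrable_norm.
apply: le_Rintegral => //.
- exact: (integrable_norm (integrable_summand m)).
- exact: (integrableZl mD `|b m| (integrable_norm iw)).
- by move=> x Dx; rewrite -normrM (le_trans (hbw _ Dx))// ler_norm.
Qed.

(** Because the bound factors as [b m * w x], the single function |w| times the sum of |b| dominates
    all partial sums, and dominated convergence exchanges sum and integral. *)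
Lemma integrable_Rintegral_zsum :
  mu.-integrable D (EFin \o (fun x => zsum [set: int] (h ^~ x))) /\
  \int[mu]_(x in D) zsum [set: int] (h ^~ x) =
    zsum [set: int] (fun m => \int[mu]_(x in D) h m x).
Proof.
have sh x : D x -> zsummable (h ^~ x).
  move=> Dx; apply: (zsummable_le (b := fun m => w x * b m)) => [m|]; last exact: zsummableZ.
  by rewrite mulrC hbw.
pose W := zsum [set: int] (fun m => `|b m|).
have sb' := zsummable_norm sb.
have [||||i c] := @dominated_cvg_Rintegral
  (fun n x => series (fold_int (h ^~ x)) n) (fun x => zsum [set: int] (h ^~ x))
  (fun x => `|w x| * W)
  _ _ _ _.
- move=> n; apply: measurable_sum => k; exact: measurable_funD.
- by move=> x Dx; apply: cvg_zsum; exact: sh.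
- exact: (integrableZr mD W (integrable_norm iw)).
- move=> n x Dx; rewrite -zsumZ//; apply: ler_norm_zsum => [m|]; last exact: zsummableZ.
  by rewrite mulrC -normrM (le_trans (hbw _ Dx))// ler_norm.


- split => //.
  rewrite zsumE; last exact: zsummable_Rintegral.
  apply/esym/cvg_lim => //; apply: cvg_trans c.
  apply: near_eq_cvg; apply: nearW => n.
  rewrite /series/= /fold_int.
  elim: n => [|n IH].
    rewrite big_nil; under eq_Rintegral do rewrite big_nil.
    by rewrite Rintegral_cst// mul0r.
  have iS k : mu.-integrable D (EFin \o (fun x => \sum_(0 <= i < k) (h (Posz i) x + h (Negz i) x))).
    elim: k => [|k IHk].
      by under [X in EFin \o X]funext do rewrite big_nil; exact: integrable0.
    under [X in EFin \o X]funext do rewrite big_nat_recr//=.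
    apply: (integrable_add IHk) => //.
    exact: (integrable_add (integrable_summand _) (integrable_summand _)).
  rewrite big_nat_recr//= -IH; under eq_Rintegral do rewrite big_nat_recr//=.
  rewrite RintegralD//; last exact: (integrable_add (integrable_summand _) (integrable_summand _)).
  by rewrite RintegralD//; exact: integrable_summand.
Qed.

End Interchange.

End DominatedSums.

(** * The heat semigroup *)

Section HeatKernel.
Variable R : realType.
Implicit Types (f a : int -> R) (m n : int) (u t : R).

Lemma zsum_reflect n a : zsum [set: int] (fun m => a (n - m)) = zsum [set: int] a.
Proof.
have bij : set_bij [set: int] [set: int] (fun m => n - m).
  split => //; first by move=> i j _ _ /addrI/oppr_inj.
  by move=> m _; exists (n - m) => //; rewrite opprB addrC subrK.
rewrite /zsum (reindex_esum _ _ _ ((EFin \o a)^\+)%E bij).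
rewrite (reindex_esum _ _ _ ((EFin \o a)^\-)%E bij); congr (fine (_ - _)%E); apply: eq_esum => m _.
  by rewrite !funeposE.
by rewrite !funenegE.
Qed.

Lemma zsummable_reflect n a : zsummable a -> zsummable (fun m => a (n - m)).
Proof.
apply: le_lt_trans; rewrite le_eqVlt; apply/predU1P; left; apply/esym.
apply: (reindex_esum [set: int] [set: int] (fun m => n - m)).
split => //; first by move=> i j _ _ /addrI/oppr_inj.
by move=> m _; exists (n - m) => //; rewrite opprB addrC subrK.
Qed.

Lemma measurable_heat_kernel m (D : set R) : measurable_fun D (@heat_kernel R ^~ m).
Proof.
apply: measurable_funTS; apply: continuous_measurable_fun.
rewrite (_ : (@heat_kernel R) ^~ m = heat_nat `|m|%N); first exact: continuous_heat_nat.
by apply/funext => u; rewrite heat_kernelE.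
Qed.

Lemma heat_kernel_ge0 u m : 0 <= u -> 0 <= heat_kernel u m.
Proof. by move=> u0; rewrite heat_kernelE heat_nat_ge0. Qed.

Lemma heat_kernel_le1 u m : 0 <= u -> heat_kernel u m <= 1.
Proof. by move=> u0; rewrite heat_kernelE heat_nat_le1. Qed.

Lemma fold_int_heat_kernel u : series (fold_int (heat_kernel u)) = (fun k => heat_mass k u).
Proof.
by apply/funext => k; apply: eq_bigr => i _; rewrite /fold_int !heat_kernelE.
Qed.

Lemma zsummable_heat_kernel u : 0 <= u -> zsummable (heat_kernel u).
Proof.
move=> u0; apply: (@zsummable_bounded _ _ 1) => k.
rewrite (_ : _ \o _ = heat_kernel u); first by rewrite fold_int_heat_kernel heat_mass_le1.
by apply/funext => m /=; rewrite ger0_norm// heat_kernel_ge0.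
Qed.

Lemma zsum_heat_kernel u : 0 <= u -> zsum [set: int] (heat_kernel u) = 1.
Proof.
move=> u0; rewrite zsumE; last exact: zsummable_heat_kernel.
by rewrite fold_int_heat_kernel; apply/cvg_lim => //; exact: cvg_heat_mass.
Qed.

Definition int_weight m : R := (`|m|%N).+1%:R.

Lemma int_weightE m : int_weight m = 1 + `|m|%:~R.
Proof. by rewrite /int_weight -nat1r -abszE. Qed.

Lemma int_weight_ge1 m : 1 <= int_weight m.
Proof. by rewrite /int_weight ler1n. Qed.

Lemma int_weight_gt0 m : 0 < int_weight m.
Proof. by rewrite /int_weight ltr0n. Qed.

(** A Peetre-type inequality. It converts decay of the kernel in n - m into decay in m, at the price
    of a factor depending only on n. *)
Lemma int_weight_submul n m : int_weight m <= int_weight n * int_weight (n - m).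
Proof. by rewrite /int_weight -natrM ler_nat; nia. Qed.

Lemma zsummable_int_weight : zsummable (fun m => (int_weight m ^+ 2)^-1 : R).
Proof.
apply: (@zsummable_bounded _ _ 3) => k.
(* The k-th folded term is a^2 + b^2 with a = 1/(k+1) and b = 1/(k+2). Since a <= 2 b, it is at most
   3 a b = 3 (a - b), which telescopes. *)
suff : series (fold_int (Num.norm \o (fun m => (int_weight m ^+ 2)^-1 : R))) k
    <= 3 - 3 * k.+1%:R^-1.
  by move=> /le_trans; apply; rewrite gerBl mulr_ge0.
elim: k => [|k]; first by rewrite /series/= big_nil invr1; lra.
rewrite /series/= big_nat_recr//= /fold_int /int_weight/= !ger0_norm ?invr_ge0//.
rewrite -!exprVn -[k.+2%:R]natr1.
have x1 : 1 <= k.+1%:R :> R by rewrite ler1n.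
have x0 : 0 < k.+1%:R :> R by rewrite ltr0n.
have y0 : 0 < k.+1%:R + 1 :> R by rewrite addr_gt0.
set x := k.+1%:R in x0 x1 y0 *; set a := x^-1; set b := (x + 1)^-1.
have a0 : 0 < a by rewrite invr_gt0.
have b0 : 0 < b by rewrite invr_gt0.
have ab : a - b = a * b.
  have gen (z : R) : 0 < z -> z^-1 - (z + 1)^-1 = z^-1 * (z + 1)^-1.
    by move=> z0; field; rewrite !gt_eqF// addr_gt0.
  exact: gen.
have ba : b <= a by rewrite -subr_ge0 ab mulr_ge0// ltW.
have a2b : a <= 2 * b by rewrite /a /b ler_pdivlMr// mulrC ler_pdivrMr//; lra.
have ha : a ^+ 2 <= 2 * (a * b) by rewrite expr2 mulrCA ler_wpM2l// ltW.
have hb : b ^+ 2 <= a * b by rewrite expr2 ler_wpM2r// ltW.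
lra.
Qed.

Lemma heat_kernel_decay n m u : 0 < u ->
  heat_kernel u (n - m) <= 4 * Num.sqrt (int_weight n) / Num.sqrt (int_weight m) * decay u.
Proof.
move=> u0; rewrite mulrAC ler_pdivlMr ?sqrtr_gt0 ?int_weight_gt0//.
rewrite (@le_trans _ _ (heat_kernel u (n - m) *
  (Num.sqrt (int_weight n) * Num.sqrt (int_weight (n - m)))))//.
  apply: ler_wpM2l; first by rewrite heat_kernel_ge0// ltW.
  rewrite -sqrtrM ?(ltW (int_weight_gt0 _ _))//.
  by rewrite ler_wsqrtr// int_weight_submul.
rewrite mulrCA [leRHS]mulrAC [leRHS]mulrC ler_wpM2l ?sqrtr_ge0//.
by rewrite mulrC heat_kernelE; exact: heat_nat_decay.
Qed.

Lemma heat_kernel_small_time n m u : 0 <= u -> m != n ->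
  heat_kernel u (n - m) <= 8 * int_weight n ^+ 2 / int_weight m ^+ 2 * u.
Proof.
move=> u0 mn; rewrite mulrAC ler_pdivlMr ?exprn_gt0 ?int_weight_gt0//.
rewrite (@le_trans _ _ (heat_kernel u (n - m) *
  (int_weight n ^+ 2 * int_weight (n - m) ^+ 2)))//.
  rewrite ler_wpM2l ?heat_kernel_ge0// -exprMn ler_pXn2r ?nnegrE ?mulr_ge0 ?(ltW (int_weight_gt0 _ _))//.
  exact: int_weight_submul.
rewrite mulrCA [leRHS]mulrAC [leRHS]mulrC.
apply: ler_wpM2l; first by rewrite exprn_ge0// ltW// int_weight_gt0.
rewrite mulrC heat_kernelE /int_weight.
case: (`|n - m|%N) (absz_eq0 (n - m)) => [|k _]; last exact: heat_natS_small_time.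
by rewrite eqxx subr_eq0 eq_sym (negbTE mn).
Qed.

End HeatKernel.

(** * Decay and small-time behaviour of the semigroup *)

Section HeatSemigroup.
Variables (R : realType) (f : int -> R).
Hypothesis hf : weighted_summable f.
Implicit Types (m n : int) (u t : R).

Lemma zsummable_weighted : zsummable (fun m => `|f m| / Num.sqrt (int_weight R m)).
Proof.
apply: zsummable_le (hf : zsummable _) => m.
by rewrite int_weightE ger0_norm// divr_ge0 ?sqrtr_ge0.
Qed.

Lemma heat_summand_decay n m u : 0 < u -> `|heat_kernel u (n - m) * f m| <=
  4 * Num.sqrt (int_weight R n) * (`|f m| / Num.sqrt (int_weight R m)) * decay u.
Proof.
move=> u0; rewrite normrM ger0_norm; last by rewrite heat_kernel_ge0// ltW.
rewrite (le_trans (ler_wpM2r _ (heat_kernel_decay n m u0)))//.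
by rewrite le_eqVlt; apply/predU1P; left; ring.
Qed.

Lemma zsummable_heat_semigroup n u : 0 < u ->
  zsummable (fun m => heat_kernel u (n - m) * f m).
Proof.
move=> u0; apply: (zsummable_le (fun m => heat_summand_decay n m u0)).
rewrite (_ : (fun _ => _) = fun m => (4 * Num.sqrt (int_weight R n) * decay u) *
   (`|f m| / Num.sqrt (int_weight R m))).
  exact/zsummableZ/zsummable_weighted.
by apply/funext => m; ring.
Qed.

Lemma heat_semigroup_decay n : exists2 C : R, 0 <= C &
  forall u, 0 < u -> `|heat_semigroup u f n| <= C * decay u.
Proof.
pose S := zsum [set: int] (fun m => `|f m| / Num.sqrt (int_weight R m)).
have S0 : 0 <= S.
  apply: le_trans (ler_zsum_norm (a := fun=> 0) _ zsummable_weighted) => // m.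
  by rewrite normr0 divr_ge0// sqrtr_ge0.
exists (4 * Num.sqrt (int_weight R n) * S); first by rewrite !mulr_ge0// sqrtr_ge0.
move=> u u0; rewrite mulrAC -zsumZ; last exact: zsummable_weighted.
apply: ler_zsum_norm => [m|]; last exact/zsummableZ/zsummable_weighted.
by rewrite (le_trans (heat_summand_decay n m u0))// mulrAC.
Qed.

(** A summable bound in m for p_u(n-m) |f(m) - f(n)| / u. The constant f(n) needs the full decay
    (1+|m|)^(-2); for f(m) the weaker weight of the hypothesis suffices. *)
Definition centered_weight n m : R := 8 * int_weight R n ^+ 2 *
  (`|f m| / Num.sqrt (int_weight R m) + `|f n| * (int_weight R m ^+ 2)^-1).

Lemma zsummable_centered_weight n : zsummable (centered_weight n).
Proof.
apply: zsummableZ; apply: zsummableD; first exact: zsummable_weighted.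
exact/zsummableZ/zsummable_int_weight.
Qed.

Lemma heat_summand_small_time n m u : 0 <= u ->
  `|heat_kernel u (n - m) * (f m - f n)| <= centered_weight n m * u.
Proof.
move=> u0; have w0 m := int_weight_gt0 R m.
have c0 : 0 <= centered_weight n m.
  rewrite !mulr_ge0 ?exprn_ge0 ?addr_ge0 ?mulr_ge0 ?invr_ge0 ?sqrtr_ge0 ?exprn_ge0//; exact: ltW.
(* The diagonal is the one site where the kernel is not O(u); there the increment of f vanishes. *)
have [->|mn] := eqVneq m n.
  rewrite [f n - f n]subrr mulr0 normr0 mulr_ge0//.
  by rewrite !mulr_ge0 ?exprn_ge0 ?addr_ge0 ?mulr_ge0 ?invr_ge0 ?sqrtr_ge0 ?exprn_ge0//; exact: ltW.
rewrite normrM ger0_norm ?heat_kernel_ge0//.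
rewrite (le_trans (ler_wpM2r _ (heat_kernel_small_time u0 mn)))//.
rewrite /centered_weight [leLHS]mulrAC ler_wpM2r// -[leLHS]mulrA ler_wpM2l//.
  by rewrite mulr_ge0// exprn_ge0// ltW.
rewrite mulrC (@le_trans _ _ ((`|f m| + `|f n|) / int_weight R m ^+ 2))//.
  by rewrite ler_wpM2r ?invr_ge0 ?exprn_ge0 ?ler_normB// ltW.
rewrite mulrDl lerD2r ler_wpM2l// lef_pV2 ?posrE ?sqrtr_gt0 ?exprn_gt0//.
have w1 := int_weight_ge1 R m.
rewrite (@le_trans _ _ (int_weight R m))//; last by rewrite expr2 ler_peMr// ltW.
rewrite -[leRHS]ger0_norm ?(ltW (w0 m))// -sqrtr_sqr ler_wsqrtr//.
by rewrite expr2 ler_peMr// ltW.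
Qed.

(** Mass one writes f(n) as the semigroup applied to the constant sequence f(n). *)
Lemma heat_semigroup_center n u : 0 < u -> heat_semigroup u f n - f n =
  zsum [set: int] (fun m => heat_kernel u (n - m) * (f m - f n)).
Proof.
move=> u0.
have sp c : zsummable (fun m => c * heat_kernel u (n - m)).
  exact/zsummableZ/zsummable_reflect/zsummable_heat_kernel/ltW.
have e : f n = zsum [set: int] (fun m => f n * heat_kernel u (n - m)).
  rewrite zsumZ ?zsum_reflect ?zsum_heat_kernel ?mulr1 ?ltW//.
  exact/zsummable_reflect/zsummable_heat_kernel/ltW.
rewrite [X in _ - X]e -zsumN// -zsumD; [|exact: zsummable_heat_semigroup|exact/zsummableN/sp].
by congr zsum; apply/funext => m; ring.
Qed.

Lemma heat_semigroup_small_time n : exists2 C : R, 0 <= C &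
  forall u, 0 < u -> `|heat_semigroup u f n - f n| <= C * u.
Proof.
exists (zsum [set: int] (centered_weight n)).
  apply: le_trans (ler_zsum_norm (a := fun=> 0) _ (zsummable_centered_weight n)) => // m.
  by have := heat_summand_small_time n m ler01; rewrite mulr1 normr0; exact: le_trans.
move=> u u0; rewrite mulrC -zsumZ; last exact: zsummable_centered_weight.
rewrite heat_semigroup_center//.
apply: ler_zsum_norm => [m|]; last exact/zsummableZ/zsummable_centered_weight.
by rewrite [leRHS]mulrC heat_summand_small_time// ltW.
Qed.

End HeatSemigroup.

(** * Integrals against Gaussian weights *)

Section Exhaustion.
Variable R : realType.
Local Notation mu := (@lebesgue_measure R).
Implicit Types (D : set R) (h dh : R -> R) (a b : nat -> R).

Lemma cvg_Rintegral_exhaustion D dh a b : measurable D ->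
  mu.-integrable D (EFin \o dh) ->
  (forall n, `[a n, b n] `<=` D) ->
  (forall x, D x -> \forall n \near \oo, a n <= x <= b n) ->
  \int[mu]_(x in `[a n, b n]) dh x @[n --> \oo] --> \int[mu]_(x in D) dh x.
Proof.
move=> mD idh abD Dab.
have e n : \int[mu]_(x in `[a n, b n]) dh x = \int[mu]_(x in D) (dh \_ `[a n, b n]) x.
  by rewrite -Rintegral_mkcondl setIidl.
under eq_cvg do rewrite e.
have mdh : measurable_fun D dh.
  by move/measurable_int : idh => /measurable_EFinP.
have [|||_ //] := @dominated_cvg_Rintegral _ _ _ mu D mD
  (fun n => dh \_ `[a n, b n]) dh (fun x => `|dh x|) _ _ (integrable_norm idh) _.
- by move=> n; apply/measurable_restrict => //; apply: measurable_funS mdh => //; exact: subIsetr.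
- move=> x Dx; apply: cvg_near_cst; have := Dab x Dx; apply: filterS => n xab.
  by rewrite patchE mem_set// /= in_itv.
- by move=> n x Dx; rewrite patchE; case: ifP; rewrite ?normr0.
Qed.

(** The fundamental theorem on compact subintervals, passed to D by dominated convergence with |dh|.
    The integrand may change sign, and integrability is assumed rather than deduced from a limit of
    h. *)
Lemma cvg_exhaustion_FTC D h dh a b : measurable D ->
  mu.-integrable D (EFin \o dh) ->
  (forall n, a n < b n) ->
  (forall n, `[a n, b n] `<=` D) ->
  (forall x, D x -> \forall n \near \oo, a n <= x <= b n) ->
  (forall x, D x -> is_derive x 1 h (dh x)) ->
  (forall x, D x -> {for x, continuous dh}) ->
  h (b n) - h (a n) @[n --> \oo] --> \int[mu]_(x in D) dh x.
Proof.
move=> mD idh ab abD Dab hD cD.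
apply: cvg_trans (cvg_Rintegral_exhaustion mD idh abD Dab).
apply: near_eq_cvg; apply: nearW => n.
have cont x : D x -> {for x, continuous h}.
  move=> /hD hx; apply: differentiable_continuous; apply/derivable1_diffP.
  exact: (@ex_derive _ _ _ _ _ _ _ hx).
have Da : D (a n) by apply: (abD n); rewrite /= in_itv/= lexx ltW.
have Db : D (b n) by apply: (abD n); rewrite /= in_itv/= lexx ltW.
have abD' x : x \in `]a n, b n[ -> D x.
  by move=> xab; apply: (abD n); exact: subset_itv_oo_cc.
rewrite /Rintegral (continuous_FTC2 (ab n) _ _ (F := h)).
- by [].
- by apply: continuous_in_subspaceT => x /set_mem/abD; exact: cD.
- split; first by move=> x /abD'/hD hx; exact: (@ex_derive _ _ _ _ _ _ _ hx).
    by apply: cvg_at_right_filter; exact: cont.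
  by apply: cvg_at_left_filter; exact: cont.
- by move=> x /abD'/hD hx; rewrite derive1E; exact: derive_val.
Qed.

Lemma Rintegral_FTC_oy h dh (l0 l : R) :
  mu.-integrable `]0, +oo[ (EFin \o dh) ->
  (forall x : R, 0 < x -> is_derive x 1 h (dh x)) ->
  (forall x : R, 0 < x -> {for x, continuous dh}) ->
  h x @[x --> (0 : R)^'+] --> l0 -> h x @[x --> +oo] --> l ->
  \int[mu]_(x in `]0, +oo[) dh x = l - l0.
Proof.
move=> idh hD cD h0 hy.
(* Starting at 2 gives [a n < 1 < b n] for every n. *)
pose a n : R := n.+2%:R^-1; pose b n : R := n.+2%:R.
have a0 n : 0 < a n by rewrite invr_gt0.
have a1 n : a n < 1 by rewrite invf_lt1 ?ltr0n// ltr1n.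
have b1 n : 1 < b n by rewrite ltr1n.
have ca : a n @[n --> \oo] --> 0.
  by have := @cvg_harmonic R; rewrite -(cvg_shiftS (harmonic : R^nat)).
have cb : b n @[n --> \oo] --> +oo.
  by rewrite /b; under eq_fun do rewrite -addn2; have := @cvgr_idn R; rewrite -(cvg_shiftn 2).
have Dx (x : R) : `]0, +oo[%classic x -> 0 < x by rewrite /= in_itv/= andbT.
have key : h (b n) - h (a n) @[n --> \oo] --> \int[mu]_(x in `]0, +oo[) dh x.
  apply: cvg_exhaustion_FTC => //.
  - by move=> n; rewrite (lt_trans (a1 n)).
  - by move=> n x; rewrite /= !in_itv/= andbT => /andP[+ _]; exact: lt_le_trans.
  - move=> x /Dx x0; near=> n; apply/andP; split; near: n.
      exact: (cvgr_le _ ca).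
    exact: (cvgry_ge cb).
  - by move=> x /Dx; exact: hD.
  - by move=> x /Dx; exact: cD.
rewrite -(cvg_lim _ key)//.
apply/cvg_lim => //; apply: cvgB.
  by move/cvg_pinftyP : hy; exact.
by move/cvg_at_rightP : h0; apply; split.
Unshelve. all: by end_near. Qed.

End Exhaustion.

(** * An integrable majorant on the half-line *)

Section Dominator.
Variable R : realType.
Local Notation mu := (@lebesgue_measure R).
Implicit Types (u : R).

(** This is (1+u)^(-5/4): the decay of F times the 1/u of the measure du/u, regularised at 0. Up to
    constants it is the common majorant of the integrands on the half-line. *)
Definition dominator u : R := decay u / (1 + u).

Lemma dominatorE u : 0 <= u -> dominator u = (1 + u) `^ (- 4^-1 - 1).
Proof.
move=> u0; have v0 : 0 < 1 + u by rewrite ltr_pwDl.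
by rewrite /dominator /decay powRB ?powRr1 ?(ltW v0)// (gt_eqF v0) implybT.
Qed.

Lemma decay_le1 u : 0 <= u -> decay u <= 1.
Proof.
by move=> u0; rewrite /decay -[leRHS](powRr0 (1 + u)) ler_powR// lerDl.
Qed.

Lemma dominator_ge0 u : 0 <= u -> 0 <= dominator u.
Proof. by move=> u0; rewrite divr_ge0 ?decay_ge0// addr_ge0. Qed.

Lemma is_derive_decay u : 0 < 1 + u -> is_derive u 1 (@decay R) (- 4^-1 * (1 + u) `^ (- 4^-1 - 1)).
Proof.
move=> v0.
have := is_derive1_comp (is_derive1_powR (- 4^-1) v0)
  (is_deriveD (is_derive_cst (1 : R) u 1) (is_derive_id u 1)).
by move=> /is_derive_eq; apply; rewrite add0r mulr1.
Qed.

Lemma continuous_decay u : 0 < 1 + u -> {for u, continuous (@decay R)}.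
Proof.
move=> v0; apply: differentiable_continuous; apply/derivable1_diffP.
exact: (@ex_derive _ _ _ _ _ _ _ (is_derive_decay v0)).
Qed.

Lemma continuous_dominator u : 0 < 1 + u -> {for u, continuous dominator}.
Proof.
move=> v0; apply: cvgM; first exact: continuous_decay.
apply: cvgV; first by rewrite gt_eqF.
by apply: cvgD; [exact: cvg_cst|exact: cvg_id].
Qed.

Lemma cvg_decay_pinfty : decay u @[u --> +oo] --> (0 : R).
Proof.
apply/cvgrPdist_le => e e0; near=> u.
have u0 : 0 <= u by near: u; apply: nbhs_pinfty_ge; rewrite num_real.
rewrite sub0r normrN ger0_norm ?decay_ge0// /decay powRN.
rewrite -[leRHS]invrK lef_pV2 ?posrE ?invr_gt0 ?powR_gt0 ?ltr_pwDl//.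
have ei : 0 <= e^-1 by rewrite invr_ge0 ltW.
have -> : e^-1 = (e^-1 ^+ 4) `^ 4^-1.
  by rewrite -powR_mulrn// -powRrM mulfV ?powRr1// pnatr_eq0.
apply: ge0_ler_powR; rewrite ?nnegrE ?exprn_ge0 ?addr_ge0//.
by apply: ler_wpDl => //; near: u; apply: nbhs_pinfty_ge; rewrite num_real.
Unshelve. all: by end_near. Qed.

Lemma integrable_dominator : mu.-integrable `]0, +oo[ (EFin \o dominator).
Proof.
have i : mu.-integrable `[0, +oo[ (EFin \o dominator).
  apply/integrableP; split.
    apply/measurable_EFinP; apply: subspace_continuous_measurable_fun => //.
    apply: continuous_in_subspaceT => x /set_mem; rewrite /= in_itv/= andbT => x0.
    by apply: continuous_dominator; rewrite ltr_pwDl.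
  have -> : (\int[mu]_(x in `[0%R, +oo[) `|(EFin \o dominator) x| =
      \int[mu]_(x in `[0%R, +oo[) (dominator x)%:E)%E.
    apply: eq_integral => u; rewrite inE/= in_itv/= andbT => u0.
    by rewrite ger0_norm ?dominator_ge0.
  have v0 (x : R) : 0 <= x -> 0 < 1 + x by move=> x0; rewrite ltr_pwDl.
  (* The antiderivative -4 (1+u)^(-1/4) vanishes at infinity, so the integral is finite. *)
  have dF (x : R) : 0 <= x -> is_derive x 1 (fun u => - 4 * decay u) (dominator x).
    move=> x0; have := is_deriveZ (-4) (is_derive_decay (v0 _ x0)).
    move=> /is_derive_eq; apply; rewrite dominatorE// /GRing.scale/= mulrA mulrNN.
    by rewrite mulfV ?mul1r// pnatr_eq0.
  suff -> : (\int[mu]_(x in `[0%R, +oo[) (dominator x)%:E = 0%:E - (- 4 * decay 0)%:E)%E.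
    by rewrite -EFinB ltry.
  apply: (@ge0_continuous_FTC2y R dominator (fun u => - 4 * decay u) 0 0).
  - by move=> x; exact: dominator_ge0.
  - apply: continuous_in_subspaceT => x /set_mem; rewrite /= in_itv/= andbT => x0.
    exact/continuous_dominator/v0.
  - by rewrite -[X in _ --> X](mulr0 (-4)); apply: cvgMr; exact: cvg_decay_pinfty.
  - by move=> x /ltW/dF dx; exact: (@ex_derive _ _ _ _ _ _ _ dx).
  - apply: cvg_at_right_filter; apply: cvgMr; apply: continuous_decay; exact: v0.
  - move=> x; rewrite in_itv/= andbT => /ltW/dF dx.
    by rewrite derive1E; exact: derive_val.
apply: integrableS i => //.
by apply: subset_itv; rewrite bnd_simp.
Qed.

(** A quantity bounded near 0 and of order u^(-2) at infinity is dominated: (1+u)^2 <= 2 (1+u^2),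
    and (1+u)^(-2) <= (1+u)^(-5/4). *)
Lemma ler_dominator (A B u T : R) : 0 <= u -> 0 <= T -> T <= A -> T * u ^+ 2 <= B ->
  T <= 2 * (A + B) * dominator u.
Proof.
move=> u0 T0 TA TB.
have v0 : 0 < 1 + u by rewrite ltr_pwDl.
have le2 : ((1 + u) ^+ 2)^-1 <= dominator u.
  rewrite dominatorE// -(powR_invn _ (ltW v0)).
  by apply: (@ler_powR _ (1 + u)); [rewrite lerDl|lra].
have AB0 : 0 <= A + B.
  apply: addr_ge0; first exact: le_trans TA.
  by apply: le_trans TB; rewrite mulr_ge0// exprn_ge0.
rewrite (le_trans _ (ler_wpM2l _ le2)) ?mulr_ge0// ler_pdivlMr ?exprn_gt0//.
rewrite (@le_trans _ _ (2 * (T + T * u ^+ 2)))//; last by rewrite ler_wpM2l// lerD.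
rewrite -[X in _ <= 2 * (X + _)]mulr1 -mulrDr [leRHS]mulrCA ler_wpM2l//.
by have := sqr_ge0 (u - 1); rewrite !expr2; lra.
Qed.

End Dominator.

(** * The weights e^(-t^2/4u) / u^(k+1) *)

Section HeatWeight.
Variable R : realType.
Implicit Types (t u x : R) (k j : nat).

(** The weight of [extension] is k = 0, hence the exponent k+1. The family is closed under
    differentiation: d/dt raises k by one, and d/du produces the members k+1 and k+2. *)
Definition heat_weight k t u : R := expR (- (t ^+ 2 / (4 * u))) / u ^+ k.+1.

Lemma exprn_expRN_le j x : 0 <= x -> x ^+ j * expR (- x) <= j`!%:R.
Proof.
move=> x0; rewrite expRN ler_pdivrMr ?expR_gt0//.
case: j => [|j]; first by rewrite expr0 mul1r -expR0 ler_expR.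
rewrite mulrC -ler_pdivrMr ?ltr0n ?fact_gt0//.
by rewrite (le_trans _ (expR_ge1Dxn j x0))// lerDr.
Qed.

Lemma heat_weight_ge0 k t u : 0 < u -> 0 <= heat_weight k t u.
Proof. by move=> u0; rewrite divr_ge0 ?expR_ge0 ?exprn_ge0 ?ltW. Qed.

(** With x = t^2/4u one has u^(-j) = x^j (4/t^2)^j, and x^j e^(-x) <= j!. So the Gaussian factor
    absorbs any power of 1/u, uniformly for t >= a. *)
Lemma expR_div_exprn_le j a t u : 0 < a -> a <= t -> 0 < u ->
  expR (- (t ^+ 2 / (4 * u))) / u ^+ j <= j`!%:R * (4 / a ^+ 2) ^+ j.
Proof.
move=> a0 at_ u0; have t0 : 0 < t by exact: lt_le_trans at_.
set x := t ^+ 2 / (4 * u).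
have x0 : 0 <= x by rewrite divr_ge0 ?exprn_ge0 ?mulr_ge0 ?ltW.
have -> : expR (- x) / u ^+ j = x ^+ j * expR (- x) * (4 / t ^+ 2) ^+ j.
  rewrite mulrAC -exprMn.
  have -> : x * (4 / t ^+ 2) = u^-1 by rewrite /x; field; rewrite !gt_eqF.
  by rewrite exprVn mulrC.
apply: ler_pM.
- by rewrite mulr_ge0 ?exprn_ge0 ?expR_ge0.
- by rewrite exprn_ge0 // divr_ge0 ?exprn_ge0 ?ltW.
- exact: exprn_expRN_le.
rewrite lerXn2r ?nnegrE ?divr_ge0 ?exprn_ge0 ?(ltW a0) ?(ltW t0)//.
rewrite ler_wpM2l// lef_pV2 ?posrE ?exprn_gt0//.
by rewrite lerXn2r ?nnegrE ?(ltW a0) ?(ltW t0).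
Qed.

Lemma heat_weight_le k a : 0 < a -> exists2 M, 0 <= M &
  forall t u, a <= t -> 0 < u -> heat_weight k t u <= M / (1 + u).
Proof.
move=> a0; pose B j : R := j`!%:R * (4 / a ^+ 2) ^+ j.
have B0 j : 0 <= B j by rewrite mulr_ge0 ?exprn_ge0 ?divr_ge0 ?exprn_ge0 ?ltW.
(* [B k.+1] bounds the weight itself and [B k] bounds u times the weight. *)
exists (B k.+1 + B k); first by rewrite addr_ge0.
move=> t u at_ u0; rewrite ler_pdivlMr ?addr_gt0// mulrDr mulr1 lerD//.
  exact: expR_div_exprn_le.
rewrite /heat_weight (exprSr u) (invfM (u ^+ k)) mulrA divfK ?gt_eqF//.
exact: expR_div_exprn_le.
Qed.

Lemma is_derive_heat_weight_t k t u : 0 < u ->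
  is_derive t 1 (heat_weight k ^~ u) (- (t / 2) * heat_weight k.+1 t u).
Proof.
move=> u0.
have dg : is_derive t 1 (fun t => - (4 * u)^-1 * t ^+ 2) (- (t / (2 * u))).
  have := is_deriveZ (- (4 * u)^-1) (is_deriveX 2 (is_derive_id t 1)).
  rewrite exprfctE => /is_derive_eq; apply.
  by rewrite /GRing.scale/= expr1 mulr1; field; rewrite gt_eqF.
have := is_deriveZ (u ^+ k.+1)^-1 (is_derive1_comp (is_derive_expR _) dg).
rewrite (_ : _ \*: _ = heat_weight k ^~ u) => [/is_derive_eq|]; last first.
  apply/funext => s; change (u ^- k.+1 * expR (- (4 * u)^-1 * s ^+ 2) = heat_weight k s u).
  by rewrite /heat_weight [LHS]mulrC mulNr (mulrC _^-1).
apply; rewrite /heat_weight /GRing.scale/= (exprS _ k.+1).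
rewrite (_ : - (4 * u)^-1 * t ^+ 2 = - (t ^+ 2 / (4 * u))); last by rewrite mulNr mulrC.
by field; rewrite !gt_eqF// exprn_gt0.
Qed.

Lemma is_derive_heat_weight0 t u : 0 < u ->
  is_derive u 1 (heat_weight 0 t) (t ^+ 2 / 4 * heat_weight 2 t u - heat_weight 1 t u).
Proof.
move=> u0.
have un0 : u != 0 by rewrite gt_eqF.
have dV : is_derive u 1 (fun u : R => u^-1) (- (u ^+ 2)^-1).
  have := is_deriveV un0 (is_derive_id u 1).
  by move=> /is_derive_eq; apply; rewrite /GRing.scale/= mulr1.
have dg := is_deriveZ (- (t ^+ 2 / 4)) dV.
have := is_deriveM (is_derive1_comp (is_derive_expR _) dg) dV.
rewrite (_ : _ * _ = heat_weight 0 t) => [/is_derive_eq|]; last first.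
  apply/funext => s; change (expR (- (t ^+ 2 / 4) * s^-1) * s^-1 = heat_weight 0 t s).
  by rewrite /heat_weight expr1 invfM mulNr mulrA.
apply; rewrite /heat_weight /GRing.scale/=.
rewrite (_ : - (t ^+ 2 / 4) *: u^-1 = - (t ^+ 2 / (4 * u))); last first.
  by rewrite /GRing.scale/= invfM mulNr mulrA.
by field.
Qed.

Lemma continuous_heat_weight k t u : 0 < u -> {for u, continuous (heat_weight k t)}.
Proof.
move=> u0; have un0 : u != 0 by rewrite gt_eqF.
apply: cvgM.
  apply: continuous_cvg; first exact: continuous_expR.
  apply: cvgN; apply: cvgMr; apply: cvgV; first by rewrite mulf_neq0.
  by apply: cvgMr; exact: cvg_id.
apply: cvgV; first by rewrite expf_neq0.
exact: exprn_continuous.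
Qed.

Lemma cvg_heat_weight_pinfty u : 0 < u -> heat_weight 0 t u @[t --> +oo] --> (0 : R).
Proof.
move=> u0; apply/cvgrPdist_le => e e0; near=> t.
have t1 : 1 <= t by near: t; apply: nbhs_pinfty_ge; rewrite num_real.
have t0 : 0 < t by exact: lt_le_trans t1.
have t4 : 4 / e <= t by near: t; apply: nbhs_pinfty_ge; rewrite num_real.
rewrite sub0r normrN ger0_norm ?heat_weight_ge0// /heat_weight.
rewrite (le_trans (expR_div_exprn_le 1 t0 (lexx t) u0))// mul1r expr1.
rewrite (@le_trans _ _ (4 / t))//.
  by rewrite ler_wpM2l// lef_pV2 ?posrE ?exprn_gt0// expr2 ler_peMr// ltW.
by rewrite ler_pdivrMr// mulrC -ler_pdivrMr.
Unshelve. all: by end_near. Qed.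

Lemma measurable_heat_weight k t : measurable_fun (`]0, +oo[%classic : set R) (heat_weight k t).
Proof.
apply: open_continuous_measurable_fun; first exact: interval_open.
by move=> u; rewrite inE/= in_itv/= andbT; exact: continuous_heat_weight.
Qed.

End HeatWeight.

(** * Differentiation in t and the limit at infinity *)

Section WeightedIntegral.
Variable R : realType.
Local Notation mu := (@lebesgue_measure R).
Variables (F : R -> R) (C : R).
Hypothesis mF : measurable_fun (`]0, +oo[%classic : set R) F.
Hypothesis C0 : 0 <= C.
Hypothesis FC : forall u : R, 0 < u -> `|F u| <= C * decay u.
Implicit Types (t u x : R) (k j : nat).

Definition weighted_integral k t : R := \int[mu]_(u in `]0, +oo[) (F u * heat_weight k t u).

Lemma weighted_integrand_le k a : 0 < a -> exists2 M, 0 <= M &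
  forall t u, a <= t -> 0 < u -> `|F u * heat_weight k t u| <= M * dominator u.
Proof.
move=> a0; have [M M0 hM] := heat_weight_le k a0.
exists (C * M); first by rewrite mulr_ge0.
move=> t u at_ u0; rewrite normrM (ger0_norm (heat_weight_ge0 _ _ u0)).
rewrite (le_trans (ler_pM _ _ (FC u0) (hM _ _ at_ u0)))//.
  exact: heat_weight_ge0.
by rewrite /dominator mulrACA.
Qed.

Lemma measurable_weighted_integrand k t :
  measurable_fun (`]0, +oo[%classic : set R) (fun u => F u * heat_weight k t u).
Proof. by apply: measurable_funM => //; exact: measurable_heat_weight. Qed.

Lemma integrable_weighted_integrand k t : 0 < t ->
  mu.-integrable `]0, +oo[ (EFin \o (fun u => F u * heat_weight k t u)).
Proof.
move=> t0; have [M _ hM] := weighted_integrand_le k t0.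
apply: (integrable_le _ _ (integrable_mulr M (integrable_dominator R) _)) => //.
  exact: measurable_weighted_integrand.
by move=> u; rewrite /= in_itv/= andbT => u0; exact: hM.
Qed.

Lemma is_derive_weighted_integral k t : 0 < t ->
  is_derive t 1 (weighted_integral k) (- (t / 2) * weighted_integral k.+1 t).
Proof.
move=> t0; have t20 : 0 < t / 2 by rewrite divr_gt0.
have [M M0 hM] := weighted_integrand_le k.+1 t20.
(* On this window the lower end keeps the weights uniformly dominated, and the upper end keeps the
   factor x / 2 at most t. *)
have It : `](t / 2), (2 * t)[%classic t by rewrite /= in_itv/=; lra.
have I0 x : `](t / 2), (2 * t)[%classic x -> [/\ 0 < x, t / 2 <= x & x <= 2 * t].
  by rewrite /= in_itv/= => /andP[h1 h2]; split; rewrite ?ltW// (lt_trans t20).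
have U0 (u : R) : `]0, +oo[%classic u -> 0 < u by rewrite /= in_itv/= andbT.
pose f x u := F u * heat_weight k x u.
have dv x u : 0 < u ->
    is_derive x 1 (f ^~ u) (- (x / 2) * (F u * heat_weight k.+1 x u)).
  move=> u0; have := is_deriveZ (F u) (is_derive_heat_weight_t k x u0).
  by move=> /is_derive_eq; apply; rewrite /GRing.scale/= mulrCA.
have intf x : `](t / 2), (2 * t)[%classic x -> mu.-integrable `]0, +oo[ (EFin \o f x).
  by move=> /I0[x0 _ _]; exact: integrable_weighted_integrand.
have derf x u : `](t / 2), (2 * t)[%classic x -> `]0, +oo[%classic u -> derivable (f ^~ u) x 1.
  by move=> _ /U0 u0; exact: (@ex_derive _ _ _ _ _ _ _ (dv x u u0)).
(* The absolute value makes G nonnegative at every real u, also outside the half-line of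
   integration. *)
pose G u := t * M * `|dominator u|.
have G0 u : 0 <= G u by rewrite mulr_ge0 ?normr_ge0// mulr_ge0// ltW.
have iG : mu.-integrable `]0, +oo[ (EFin \o G).
  by apply: integrable_mulr => //; exact: (integrable_norm (integrable_dominator R)).
have pd x u : 0 < u -> partial1of2 f x u = - (x / 2) * (F u * heat_weight k.+1 x u).
  by move=> u0; rewrite partial1of2E; apply: derive_val; exact: dv.
have Gub x u : `](t / 2), (2 * t)[%classic x -> `]0, +oo[%classic u -> `|partial1of2 f x u| <= G u.
  move=> /I0[x0 tx xt] /U0 u0; rewrite pd// normrM /G -mulrA.
  have x20 : 0 <= x / 2 by rewrite divr_ge0// ltW.
  rewrite normrN (ger0_norm x20).
  apply: ler_pM => //; first by lra.
  rewrite (le_trans (hM _ _ tx u0))// ler_wpM2l// ler_norm//.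
have mD : measurable (`]0, +oo[%classic : set R) by [].
have dW := @derivable_under_integral R _ _ mu f _ mD _ _ _ It intf derf _ G0 iG Gub.
have eW := @differentiation_under_integral R _ _ mu f _ mD _ _ _ It intf derf _ G0 iG Gub.
apply: DeriveDef; first exact: dW.
rewrite -derive1E [LHS]eW.
rewrite /weighted_integral -RintegralZl//; last exact: integrable_weighted_integrand.
by apply: eq_Rintegral => u; rewrite inE => /U0 u0; rewrite pd.
Qed.

Lemma cvg_weighted_integral_pinfty : weighted_integral 0 t @[t --> +oo] --> (0 : R).
Proof.
apply/cvg_pinftyP => s sy.
have [M M0 hM] := weighted_integrand_le 0 ltr01.
(* The majorant is uniform only for t >= 1; truncation changes finitely many terms of the
   sequence. *)
pose s' n := Num.max 1 (s n).
have s'1 n : 1 <= s' n by rewrite le_max lexx.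
have U0 (u : R) : `]0, +oo[%classic u -> 0 < u by rewrite /= in_itv/= andbT.
have [|||||_] := @dominated_cvg_Rintegral _ _ _ mu `]0, +oo[ _
  (fun n u => F u * heat_weight 0 (s' n) u) (fun=> 0) (fun u => M * dominator u) _ _ _ _.
- by [].
- by move=> n; exact: measurable_weighted_integrand.
- move=> u /U0 u0; rewrite -[X in _ --> X](mulr0 (F u)); apply: cvgMr.
  apply: (cvg_comp _ _ _ (cvg_heat_weight_pinfty u0)).
  apply/cvgryPge => A; near=> n; rewrite /s' le_max; apply/orP; right.
  by near: n; move/cvgryPge : sy; apply.
- by apply: integrable_mulr => //; exact: integrable_dominator.
- by move=> n u /U0 u0; exact: hM.
rewrite (_ : \int[mu]_(x in _) 0 = 0); last by rewrite Rintegral_cst// mul0r.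
apply: cvg_trans; apply: near_eq_cvg; near=> n.
rewrite /weighted_integral /s' (@max_r _ _ 1)//.
by near: n; move/cvgryPge : sy; apply.
Unshelve. all: by end_near. Qed.

End WeightedIntegral.

(** * Limits as t tends to 0 *)

Section SmallTime.
Variable R : realType.
Local Notation mu := (@lebesgue_measure R).
Implicit Types (t u x : R).

Lemma dominated_cvg_at_right (D : set R) (f_ : R -> R -> R) (f g : R -> R) :
  measurable D -> (forall t, 0 < t -> measurable_fun D (f_ t)) ->
  (forall u, D u -> f_ t u @[t --> (0 : R)^'+] --> f u) ->
  mu.-integrable D (EFin \o g) ->
  (forall t u, 0 < t <= 1 -> D u -> `|f_ t u| <= g u) ->
  mu.-integrable D (EFin \o f) /\
  \int[mu]_(u in D) f_ t u @[t --> (0 : R)^'+] --> \int[mu]_(u in D) f u.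
Proof.
move=> mD mf_ ff ig fg.
have key (s : nat -> R) : (forall n, 0 < s n) -> s n @[n --> \oo] --> 0 ->
    mu.-integrable D (EFin \o f) /\
    \int[mu]_(u in D) f_ (s n) u @[n --> \oo] --> \int[mu]_(u in D) f u.
  (* The majorant is assumed only for t <= 1, so the sequence is truncated there; eventually it is
     unchanged. *)
  move=> s0 cs; pose s' n := Num.min 1 (s n).
  have s'0 n : 0 < s' n by rewrite lt_min ltr01 s0.
  have s's : \forall n \near \oo, s' n = s n.
    near=> n; rewrite /s' min_r//; apply: ltW; near: n.
    exact: (cvgr_lt _ cs).
  have cs' : s' n @[n --> \oo] --> 0.
    by apply: cvg_trans cs; apply: near_eq_cvg; apply: filterS s's.
  have [|||i c] := @dominated_cvg_Rintegral _ _ _ mu D mD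
    (fun n => f_ (s' n)) f g _ _ ig _.
  - by move=> n; exact: mf_.
  - by move=> u Du; have /cvg_at_rightP := ff u Du; apply; split.
  - by move=> n u Du; apply: fg => //; rewrite s'0 ge_min lexx.
  - split=> //; apply: cvg_trans c; apply: near_eq_cvg.
    by apply: filterS s's => n /= ->.
split; last by apply/cvg_at_rightP => s [s0 cs]; exact: (key s s0 cs).2.
(* Integrability of the limit does not involve t, so one admissible sequence gives it. *)
exact: (key harmonic (fun=> harmonic_gt0 _) cvg_harmonic).1.
Unshelve. all: by end_near. Qed.

Lemma cvg_sqr_at_right : t ^+ 2 @[t --> (0 : R)^'+] --> (0 : R).
Proof.
rewrite -[X in _ --> X](expr0n _ 2); apply: cvg_at_right_filter; exact: exprn_continuous.
Qed.

Lemma cvg_heat_weight0 u : 0 < u -> heat_weight 0 t u @[t --> (0 : R)^'+] --> u^-1.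
Proof.
move=> u0; rewrite /heat_weight expr1 -[X in _ --> X]mul1r; apply: cvgMl.
rewrite -[X in _ --> X](_ : expR (- (0 / (4 * u))) = 1); last by rewrite mul0r oppr0 expR0.
apply: continuous_cvg; first exact: continuous_expR.
by apply: cvgN; apply: cvgMl; exact: cvg_sqr_at_right.
Qed.

(** As a function of u on the half-line, the distribution function of the density (t^2/4)
    e^(-t^2/4u) / u^2: it rises from 0 to 1, so that density has mass one. *)
Definition gauss_factor t u : R := expR (- (t ^+ 2 / (4 * u))).

Lemma is_derive_gauss_factor t u : 0 < u ->
  is_derive u 1 (gauss_factor t) (t ^+ 2 / 4 * heat_weight 1 t u).
Proof.
move=> u0; have un0 : u != 0 by rewrite gt_eqF.
have dg := is_deriveZ (- (t ^+ 2 / 4)) (is_deriveV un0 (is_derive_id u 1)).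
have := is_derive1_comp (is_derive_expR _) dg.
rewrite (_ : _ \o _ = gauss_factor t) => [/is_derive_eq|]; last first.
  apply/funext => s; change (expR (- (t ^+ 2 / 4) * s^-1) = gauss_factor t s).
  by rewrite /gauss_factor invfM mulNr mulrA.
apply; rewrite /heat_weight /GRing.scale/= mulr1.
rewrite (_ : - (t ^+ 2 / 4) *: u^-1 = - (t ^+ 2 / (4 * u))); last first.
  by rewrite /GRing.scale/= invfM mulNr mulrA.
by field.
Qed.

Lemma gauss_factor_le1 t u : 0 < u -> gauss_factor t u <= 1.
Proof.
by move=> u0; rewrite -expR0 ler_expR oppr_le0 divr_ge0 ?sqr_ge0 ?mulr_ge0 ?ltW.
Qed.

Lemma heat_weight_mass_le t u : 0 < u -> 0 <= t ^+ 2 / 4 * heat_weight 1 t u * u <= 1.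
Proof.
move=> u0; have x0 : 0 <= t ^+ 2 / (4 * u) by rewrite divr_ge0 ?sqr_ge0 ?mulr_ge0 ?ltW.
have -> : t ^+ 2 / 4 * heat_weight 1 t u * u =
   (t ^+ 2 / (4 * u)) ^+ 1 * expR (- (t ^+ 2 / (4 * u))).
  by rewrite /heat_weight; field; rewrite gt_eqF.
by rewrite (exprn_expRN_le 1 x0) mulr_ge0 ?expR_ge0.
Qed.

Lemma integrable_heat_weight_mass t : 0 < t ->
  mu.-integrable `]0, +oo[ (EFin \o (fun u => t ^+ 2 / 4 * heat_weight 1 t u)).
Proof.
move=> t0.
pose A : R := t ^+ 2 / 4 * ((2`!)%:R * (4 / t ^+ 2) ^+ 2).
apply: (@integrable_le _ _ R mu _ _ (fun u => 2 * (A + t ^+ 2 / 4) * dominator u)) => //.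
- by apply: measurable_funM => //; exact: measurable_heat_weight.
- move=> u; rewrite /= in_itv/= andbT => u0.
  have t4 : 0 <= t ^+ 2 / 4 by rewrite divr_ge0 ?sqr_ge0.
  have T0 : 0 <= t ^+ 2 / 4 * heat_weight 1 t u by rewrite mulr_ge0 ?heat_weight_ge0.
  rewrite ger0_norm//; apply: ler_dominator => //; first exact: ltW.
    by rewrite ler_wpM2l//; exact: expR_div_exprn_le.
  rewrite -mulrA -[leRHS]mulr1 ler_wpM2l//.
  by rewrite /heat_weight divfK ?expf_neq0 ?gt_eqF//; exact: gauss_factor_le1.
- by apply: integrable_mulr => //; exact: integrable_dominator.
Qed.

Lemma Rintegral_heat_weight_mass t : 0 < t ->
  \int[mu]_(u in `]0, +oo[) (t ^+ 2 / 4 * heat_weight 1 t u) = 1.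
Proof.
move=> t0.
have h0 : gauss_factor t u @[u --> (0 : R)^'+] --> (0 : R).
  apply: (@squeeze_cvgr _ _ _ _ (fun=> 0) (fun u => u * (4 / t ^+ 2))).
  - near=> u; have u0 : 0 < u by near: u; exact: nbhs_right_gt.
    rewrite expR_ge0/=.
    have := expR_div_exprn_le 1 t0 (lexx t) u0.
    by rewrite (_ : 1`!%:R = 1)// mul1r !expr1 ler_pdivrMr// [4 / _ * u]mulrC.
  - exact: cvg_cst.
  - rewrite -[X in _ --> X](mul0r (4 / t ^+ 2)); apply: cvgMl.
    by apply: cvg_at_right_filter; exact: cvg_id.
have hy : gauss_factor t u @[u --> +oo] --> (1 : R).
  rewrite -[X in _ --> X](_ : expR (- (t ^+ 2 / 4 * 0)) = 1); last first.
    by rewrite mulr0 oppr0 expR0.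
  rewrite (_ : gauss_factor t = fun u => expR (- (t ^+ 2 / 4 * u^-1))); last first.
    by apply/funext => u; rewrite /gauss_factor invfM mulrA.
  apply: continuous_cvg; first exact: continuous_expR.
  apply: cvgN; apply: cvgMr.
  apply/cvgrPdist_le => e e0; near=> u.
  have u1 : 0 < u by near: u; apply: nbhs_pinfty_gt; rewrite num_real.
  have ue : e^-1 <= u by near: u; apply: nbhs_pinfty_ge; rewrite num_real.
  have ui : 0 <= u^-1 by rewrite invr_ge0 ltW.
  rewrite sub0r normrN (ger0_norm ui).
  by rewrite -[leRHS]invrK lef_pV2 ?posrE ?invr_gt0.
have cD u : 0 < u -> {for u, continuous (fun u => t ^+ 2 / 4 * heat_weight 1 t u)}.
  by move=> u0; apply: cvgMr; exact: continuous_heat_weight.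
rewrite -[RHS]subr0.
exact: (Rintegral_FTC_oy (integrable_heat_weight_mass t0)
  (is_derive_gauss_factor t) cD h0 hy).
Unshelve. all: by end_near. Qed.

Variables (F : R -> R) (C C1 F0 : R).
Hypothesis mF : measurable_fun (`]0, +oo[%classic : set R) F.
Hypothesis C0 : 0 <= C.
Hypothesis FC : forall u : R, 0 < u -> `|F u| <= C * decay u.
Hypothesis C10 : 0 <= C1.
Hypothesis FF0 : forall u : R, 0 < u -> `|F u - F0| <= C1 * u.

Let U0 (u : R) : `]0, +oo[%classic u -> 0 < u.
Proof. by rewrite /= in_itv/= andbT. Qed.

(** The density (t^2/4) [heat_weight 1 t] is an approximate identity at u = 0. Subtracting F0
    against its unit mass leaves an integrand that tends to 0 at each fixed u. *)
Lemma cvg_weighted_integral1 :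
  t ^+ 2 / 4 * weighted_integral F 1 t @[t --> (0 : R)^'+] --> F0.
Proof.
pose g t u := (F u - F0) * (t ^+ 2 / 4 * heat_weight 1 t u).
have FB u : 0 < u -> `|F u - F0| <= C + `|F0|.
  move=> u0; rewrite (le_trans (ler_normB _ _))// lerD2r.
  by rewrite (le_trans (FC u0))// ler_piMr// decay_le1// ltW.
have hw0 t u : 0 < u -> 0 <= t ^+ 2 / 4 * heat_weight 1 t u.
  by move=> u0; rewrite mulr_ge0 ?heat_weight_ge0// divr_ge0 ?sqr_ge0.
have hwle t u : 0 < u -> t ^+ 2 / 4 * heat_weight 1 t u * u ^+ 2 <= t ^+ 2 / 4.
  move=> u0; rewrite -mulrA -[leRHS]mulr1 ler_wpM2l ?divr_ge0 ?sqr_ge0//.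
  by rewrite /heat_weight divfK ?expf_neq0 ?gt_eqF//; exact: gauss_factor_le1.
(* Near 0, |F - F0| <= C1 u and u times the density is at most 1. At infinity, |F - F0| <= C + |F0|
   and u^2 times the density is at most t^2/4. *)
have [|||||_ c] := @dominated_cvg_at_right `]0, +oo[ g (fun=> 0)
  (fun u => 2 * (C1 + (C + `|F0|)) * dominator u) _ _ _ _ _.
- by [].
- move=> t t0; apply: measurable_funM; first exact: measurable_funB.
  by apply: measurable_funM => //; exact: measurable_heat_weight.
- move=> u /U0 u0; rewrite -[X in _ --> X](mulr0 (F u - F0)); apply: cvgMr.
  apply: (@squeeze_cvgr _ _ _ _ (fun=> 0) (fun t => t ^+ 2 * (4 * u ^+ 2)^-1)).
  + near=> t; rewrite hw0//=.
    have -> : t ^+ 2 * (4 * u ^+ 2)^-1 = t ^+ 2 / 4 / u ^+ 2 by rewrite invfM mulrA.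
    by rewrite ler_pdivlMr ?exprn_gt0//; exact: hwle.
  + exact: cvg_cst.
  + rewrite -[X in _ --> X](mul0r (4 * u ^+ 2)^-1); apply: cvgMl.
    exact: cvg_sqr_at_right.
- by apply: integrable_mulr => //; exact: integrable_dominator.
- move=> t u /andP[t0 t1] /U0 u0; apply: ler_dominator => //; first exact: ltW.
    rewrite normrM (ger0_norm (hw0 _ _ u0)).
    rewrite (le_trans (ler_wpM2r (hw0 _ _ u0) (FF0 u0)))//.
    rewrite -(mulrA C1) ler_piMr// mulrC.
    by have /andP[] := heat_weight_mass_le t u0.
  rewrite normrM (ger0_norm (hw0 _ _ u0)) -[leLHS]mulrA.
  have h1 : t ^+ 2 / 4 * heat_weight 1 t u * u ^+ 2 <= 1.
    rewrite (le_trans (hwle t u u0))// ler_pdivrMr// mul1r.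
    rewrite (@le_trans _ _ 1)//; last by rewrite ler1n.
    by rewrite expr_le1// ltW.
  rewrite -[leRHS]mulr1; apply: (ler_pM _ _ (FB u u0) h1) => //.
  by rewrite mulr_ge0 ?exprn_ge0 ?(ltW u0)//; exact: hw0.
have : F0 + \int[mu]_(u in `]0, +oo[) g t u @[t --> (0 : R)^'+] --> F0.
  rewrite -[X in _ --> X]addr0; apply: cvgD; first exact: cvg_cst.
  by rewrite Rintegral_cst// mul0r in c.
apply: cvg_trans; apply: near_eq_cvg; near=> t.
have t0 : 0 < t by near: t; exact: nbhs_right_gt.
have i1 := integrable_weighted_integrand mF C0 FC 1 t0.
rewrite /weighted_integral -RintegralZl//.
rewrite -[X in X + _]mulr1 -[X in F0 * X + _](Rintegral_heat_weight_mass t0) -RintegralZl//; last first.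
  exact: integrable_heat_weight_mass.
have iF0 := integrable_mulr F0 (integrable_heat_weight_mass t0) (measurable_itv _).
have iD := integrable_mulr (t ^+ 2 / 4) i1 (measurable_itv _).
rewrite -RintegralD//; last first.
  apply: eq_integrable_fun (integrable_sub iD iF0 _) _ => // u _.
  by rewrite /g; ring.
by apply: eq_Rintegral => u _; rewrite /g; ring.
Unshelve. all: by end_near. Qed.

Lemma integrable_oy_sub (D : set R) (g : R -> R) : measurable D ->
  D `<=` `]0, +oo[ -> mu.-integrable `]0, +oo[ (EFin \o g) -> mu.-integrable D (EFin \o g).
Proof. by move=> mD DU; apply: integrableS. Qed.

Lemma Rintegral_split1 (g : R -> R) : mu.-integrable `]0, +oo[ (EFin \o g) ->
  \int[mu]_(u in `]0, +oo[) g u =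
  \int[mu]_(u in `]0, 1[) g u + \int[mu]_(u in `]1, +oo[) g u.
Proof.
move=> ig; rewrite -(@Rintegral_itvB _ _ (BRight 0) +oo%O 1)//; last by rewrite bnd_simp.
rewrite Rintegral_itv_bndo_bndc; first by rewrite addrC subrK.
apply: integrable_oy_sub ig => //.
by apply: subset_itvl; rewrite bnd_simp.
Qed.

Lemma integrable_heat_weight0c1 t : 0 < t ->
  mu.-integrable `]0, 1] (EFin \o heat_weight 0 t).
Proof.
move=> t0; pose B : R := 1`!%:R * (4 / t ^+ 2) ^+ 1.
have sD1 : `]0, 1] `<=` (`]0, +oo[%classic : set R) by apply: subset_itvl; rewrite bnd_simp.
apply: (@integrable_le _ _ R mu _ _ (fun u => 2 * (B + B) * dominator u)) => //.
- by apply: measurable_funS (measurable_heat_weight _ _).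
- move=> u; rewrite /= in_itv/= => /andP[u0 u1].
  have hB : heat_weight 0 t u <= B by exact: expR_div_exprn_le.
  have h0 := heat_weight_ge0 0 t u0.
  rewrite (ger0_norm h0); apply: ler_dominator => //; first exact: ltW.
  by rewrite (le_trans _ hB)// ler_piMr// expr_le1// ltW.
- by apply: integrable_oy_sub => //; apply: integrable_mulr => //; exact: integrable_dominator.
Qed.

Lemma integrable_heat_weight01 t : 0 < t ->
  mu.-integrable `]0, 1[ (EFin \o heat_weight 0 t).
Proof.
move=> t0; apply: integrableS (integrable_heat_weight0c1 t0) => //.
exact: subset_itv_oo_oc.
Qed.

(** F/u behaves like F0/u at 0 and may fail to be integrable there, so F0 times the integral of the
    weight over (0, 1) is removed before t tends to 0. The cut at u = 1 is the one separating [W0]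
    from [Winf]. *)
Lemma cvg_weighted_integral0 :
  [/\ mu.-integrable `]0, 1[ (EFin \o (fun u => (F u - F0) / u)),
      mu.-integrable `]1, +oo[ (EFin \o (fun u => F u / u)) &
  weighted_integral F 0 t - F0 * \int[mu]_(u in `]0, 1[) heat_weight 0 t u
    @[t --> (0 : R)^'+] -->
  \int[mu]_(u in `]0, 1[) ((F u - F0) / u) + \int[mu]_(u in `]1, +oo[) (F u / u)].
Proof.
have D1 (u : R) : `]0, 1[%classic u -> 0 < u < 1 by rewrite /= in_itv.
have D2 (u : R) : `]1, +oo[%classic u -> 1 < u by rewrite /= in_itv/= andbT.
have sD1 : `]0, 1[ `<=` (`]0, +oo[%classic : set R) by apply: subset_itvl; rewrite bnd_simp.
have sD2 : `]1, +oo[ `<=` (`]0, +oo[%classic : set R) by apply: subset_itvr; rewrite bnd_simp.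
have hwle t u : 0 < u -> heat_weight 0 t u <= u^-1.
  by move=> u0; rewrite -[leRHS]mul1r /heat_weight expr1 ler_wpM2r ?invr_ge0 ?(ltW u0)//;
    exact: gauss_factor_le1.
have [|||||i1 c1] := @dominated_cvg_at_right `]0, 1[ (fun t u => (F u - F0) * heat_weight 0 t u)
  (fun u => (F u - F0) / u) (fun u => 2 * (C1 + C1) * dominator u) _ _ _ _ _.
- by [].
- move=> t t0; apply: measurable_funM.
    by apply: measurable_funB => //; exact: measurable_funS mF.
  by apply: measurable_funS (measurable_heat_weight _ _).
- by move=> u /D1 /andP[u0 _]; apply: cvgMr; exact: cvg_heat_weight0.
- apply: integrable_oy_sub => //; apply: integrable_mulr => //; exact: integrable_dominator.
- move=> t u _ /D1 /andP[u0 u1].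
  have TC : `|(F u - F0) * heat_weight 0 t u| <= C1.
    rewrite normrM (ger0_norm (heat_weight_ge0 _ _ u0)).
    have -> : C1 = C1 * u * u^-1 by rewrite mulfK// gt_eqF.
    apply: ler_pM => //; [exact: heat_weight_ge0|exact: FF0|exact: hwle].
  apply: ler_dominator => //; first exact: ltW.
  rewrite (le_trans _ TC)// ler_piMr//.
  by rewrite expr_le1// ltW.
have [|||||i2 c2] := @dominated_cvg_at_right `]1, +oo[ (fun t u => F u * heat_weight 0 t u)
  (fun u => F u / u) (fun u => C * 2 * dominator u) _ _ _ _ _.
- by [].
- move=> t t0; apply: measurable_funM; first exact: measurable_funS mF.
  by apply: measurable_funS (measurable_heat_weight _ _).
- by move=> u /D2 u1; apply: cvgMr; apply: cvg_heat_weight0; exact: lt_trans u1.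
- apply: integrable_oy_sub => //; apply: integrable_mulr => //; exact: integrable_dominator.
- move=> t u _ /D2 u1; have u0 : 0 < u by exact: lt_trans u1.
  rewrite normrM (ger0_norm (heat_weight_ge0 _ _ u0)).
  have -> : C * 2 * dominator u = (C * decay u) * (2 / (1 + u)).
    by rewrite /dominator; ring.
  apply: ler_pM => //; [exact: heat_weight_ge0|exact: FC|].
  rewrite (le_trans (hwle _ _ u0))// ler_pdivlMr ?addr_gt0// mulrC ler_pdivrMr//.
  by lra.
split => //.
apply: cvg_trans (cvgD c1 c2); apply: near_eq_cvg; near=> t.
have t0 : 0 < t by near: t; exact: nbhs_right_gt.
have ihw := integrable_heat_weight01 t0.
have iF := integrable_weighted_integrand mF C0 FC 0 t0.
have iF1 := integrable_oy_sub (measurable_itv _) sD1 iF.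
have iF0 := integrable_mulr F0 ihw (measurable_itv _).
rewrite /weighted_integral (Rintegral_split1 iF) -RintegralZl// addrAC.
rewrite -RintegralB//; congr (_ + _).
by apply: eq_Rintegral => u _; rewrite mulrBl.
Unshelve. all: by end_near. Qed.

End SmallTime.

(** * The exponential integral *)

Section ExponentialIntegral.
Variable R : realType.
Local Notation mu := (@lebesgue_measure R).
Implicit Types (t u v x : R).

Definition ein_integrand v : R := (1 - expR (- v)) / v.

(** The classical entire exponential integral Ein, for positive x. *)
Definition ein x : R := \int[mu]_(v in `]0, x]) ein_integrand v.

Lemma ein_integrand_bounds v : 0 < v -> 0 <= ein_integrand v <= 1.
Proof.
move=> v0; rewrite divr_ge0 ?(ltW v0)//=; last first.
  by rewrite subr_ge0 -expR0 ler_expR oppr_le0 ltW.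
by rewrite ler_pdivrMr// mul1r lerBlDr -lerBlDl; exact: expR_ge1Dx.
Qed.

Lemma continuous_expRN v : {for v, continuous (fun v => expR (- v) : R)}.
Proof. by apply: continuous_cvg; [exact: continuous_expR|apply: cvgN; exact: cvg_id]. Qed.

Lemma continuous_ein_integrand v : 0 < v -> {for v, continuous ein_integrand}.
Proof.
move=> v0; apply: cvgM; first by apply: cvgB; [exact: cvg_cst|exact: continuous_expRN].
by apply: cvgV; [rewrite gt_eqF|exact: cvg_id].
Qed.

Lemma measurable_ein_integrand : measurable_fun (`]0, +oo[%classic : set R) ein_integrand.
Proof.
apply: open_continuous_measurable_fun; first exact: interval_open.
by move=> u; rewrite inE/= in_itv/= andbT; exact: continuous_ein_integrand.
Qed.

Lemma integrable_ein_integrand x : mu.-integrable `]0, x] (EFin \o ein_integrand).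
Proof.
have sD : `]0, x] `<=` (`]0, +oo[%classic : set R) by apply: subset_itvl; rewrite bnd_simp.
apply: (@integrable_le _ _ R mu _ _ (fun u => 2 * (1 + x ^+ 2) * dominator u)) => //.
- by apply: measurable_funS measurable_ein_integrand.
- move=> u; rewrite /= in_itv/= => /andP[u0 ux].
  have /andP[h0 h1] := ein_integrand_bounds u0.
  rewrite (ger0_norm h0); apply: ler_dominator => //; first exact: ltW.
  rewrite (@le_trans _ _ (u ^+ 2))//; first by rewrite ler_piMl// sqr_ge0.
  by rewrite lerXn2r ?nnegrE ?(ltW u0)// (le_trans _ ux)// ltW.
- by apply: integrable_oy_sub => //; apply: integrable_mulr => //; exact: integrable_dominator.
Qed.

Lemma is_derive_ein x : 0 < x -> is_derive x 1 ein (ein_integrand x).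
Proof.
move=> x0.
have x1 : x < x + 1 by rewrite ltrDl.
have [||d e] := @continuous_FTC1 R ein_integrand (BRight 0) x (x + 1) x1 (integrable_ein_integrand _).
- exact: x0.
- exact: continuous_ein_integrand.
- by apply: DeriveDef; [exact: d|rewrite -derive1E; exact: e].
Qed.

Lemma ein_bounds x : 0 < x -> 0 <= ein x <= x.
Proof.
move=> x0; have x0' (v : R) : `]0, x]%classic v -> 0 < v by rewrite /= in_itv/= => /andP[].
apply/andP; split.
  by apply: Rintegral_ge0 => v /x0'/ein_integrand_bounds/andP[].
rewrite (@le_trans _ _ (\int[mu]_(v in `]0, x]) 1))//.
  apply: le_Rintegral => //; first exact: integrable_ein_integrand.
    apply: measurable_bounded_integrable => //.
    - by rewrite /= lebesgue_measure_itv/=; case: ifP => _ //; rewrite -EFinD ltry.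
    - exact: bounded_cst.
  by move=> v /x0'/ein_integrand_bounds/andP[].
by rewrite Rintegral_cst// mul1r /= lebesgue_measure_itv/= lte_fin x0/= subr0.
Qed.

Lemma cvg_ein_at_right : ein x @[x --> (0 : R)^'+] --> (0 : R).
Proof.
apply: (@squeeze_cvgr _ _ _ _ (fun=> 0) id).
- near=> x; apply: ein_bounds; near: x; exact: nbhs_right_gt.
- exact: cvg_cst.
- by apply: cvg_at_right_filter; exact: cvg_id.
Unshelve. all: by end_near. Qed.

(** Classically this is -gamma - E_1(x), an antiderivative of e^(-x)/x whose singularity at 0 is the
    explicit ln x. *)
Definition log_ein x : R := ln x - ein x.

Lemma is_derive_log_ein x : 0 < x -> is_derive x 1 log_ein (expR (- x) / x).
Proof.
move=> x0; have := is_deriveB (is_derive1_ln x0) (is_derive_ein x0).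
move=> /is_derive_eq; apply.
by rewrite /ein_integrand; field; rewrite gt_eqF.
Qed.

Lemma continuous_expRN_div v : 0 < v -> {for v, continuous (fun v => expR (- v) / v : R)}.
Proof.
move=> v0; apply: cvgM; first exact: continuous_expRN.
by apply: cvgV; [rewrite gt_eqF|exact: cvg_id].
Qed.

Lemma integrable_expRN_div c : 0 < c ->
  mu.-integrable `[c, +oo[ (EFin \o (fun v => expR (- v) / v)).
Proof.
move=> c0.
have sD : `[c, +oo[ `<=` (`]0, +oo[%classic : set R) by apply: subset_itvr; rewrite bnd_simp.
apply: (@integrable_le _ _ R mu _ _ (fun u => 2 * (c^-1 + 1) * dominator u)) => //.
- apply: measurable_funS sD _ => //.
  apply: open_continuous_measurable_fun; first exact: interval_open.
  by move=> u; rewrite inE/= in_itv/= andbT; exact: continuous_expRN_div.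
- move=> v; rewrite /= in_itv/= andbT => cv.
  have v0 : 0 < v by exact: lt_le_trans cv.
  have T0 : 0 <= expR (- v) / v by rewrite divr_ge0 ?expR_ge0// ltW.
  rewrite (ger0_norm T0); apply: ler_dominator => //; first exact: ltW.
    rewrite -[leRHS]mul1r; apply: ler_pM; rewrite ?expR_ge0 ?invr_ge0 ?(ltW v0)//.
      by rewrite -expR0 ler_expR oppr_le0 ltW.
    by rewrite lef_pV2 ?posrE.
  rewrite expr2 mulrA divfK ?gt_eqF// mulrC.
  by have := exprn_expRN_le 1 (ltW v0); rewrite expr1.
- by apply: integrable_oy_sub => //; apply: integrable_mulr => //; exact: integrable_dominator.
Qed.

(** The offset d lets one sequence serve two exhaustions: it exceeds c, and it exceeds d, so d / (d
    + c + n + 1) < 1 is a valid lower endpoint after the substitution v = d/u. *)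
Lemma cvg_log_ein_tail c d : 0 < c -> 0 < d ->
  log_ein (d + c + n.+1%:R) @[n --> \oo] -->
  \int[mu]_(v in `]c, +oo[) (expR (- v) / v) + log_ein c.
Proof.
move=> c0 d0; rewrite Rintegral_itv_obnd_cbnd; last first.
  apply: integrableS (integrable_expRN_div c0) => //.
  by apply: subset_itv; rewrite bnd_simp.
have Dc (x : R) : `[c, +oo[%classic x -> c <= x by rewrite /= in_itv/= andbT.
have := @cvg_exhaustion_FTC R `[c, +oo[ log_ein (fun v => expR (- v) / v) (fun=> c)
  (fun n => d + c + n.+1%:R) (measurable_itv _) (integrable_expRN_div c0).
move=> h; rewrite -[X in X @ _ --> _](_ :
  (fun n => (log_ein (d + c + n.+1%:R) - log_ein c) + log_ein c) = _); last first.
  by apply/funext => n; rewrite subrK.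
apply: cvgD; last exact: cvg_cst.
apply: h.
- by move=> n; rewrite -addrA addrCA ltrDl addr_gt0.
- by move=> n x; rewrite /= !in_itv/= andbT => /andP[].
- move=> x /Dc cx; near=> n; rewrite cx/=.
  rewrite (@le_trans _ _ n.+1%:R)//; last by rewrite lerDr addr_ge0// ltW.
  rewrite (@le_trans _ _ n%:R)// ?ler_nat//.
  by near: n; exact: nbhs_infty_ger.
- by move=> x /Dc cx; apply: is_derive_log_ein; exact: lt_le_trans cx.
- by move=> x /Dc cx; apply: continuous_expRN_div; exact: lt_le_trans cx.
Unshelve. all: by end_near. Qed.

(** The substitution v = t^2/4u maps (0, 1) onto (t^2/4, oo). It is carried out through the
    antiderivative -[log_ein] (t^2/4u), and the limit at infinity is expressed by the tail integral
    from 1/4. *)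
Lemma Rintegral_heat_weight01 t : 0 < t ->
  \int[mu]_(u in `]0, 1[) heat_weight 0 t u =
  \int[mu]_(v in `]4^-1, +oo[) (expR (- v) / v) + log_ein 4^-1 - log_ein (t ^+ 2 / 4).
Proof.
move=> t0; set c := t ^+ 2 / 4.
have c0 : 0 < c by rewrite divr_gt0// exprn_gt0.
have D0 (x : R) : `]0, 1]%classic x -> 0 < x <= 1 by rewrite /= in_itv.
have q0 : 0 < 4^-1 :> R by rewrite invr_gt0.
have tail := cvg_log_ein_tail q0 c0.
have k0 n : 0 < c + 4^-1 + n.+1%:R by rewrite !addr_gt0.
have := @cvg_exhaustion_FTC R `]0, 1] (fun u => - log_ein (c / u)) (heat_weight 0 t)
  (fun n => c / (c + 4^-1 + n.+1%:R)) (fun=> 1) (measurable_itv _).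
rewrite Rintegral_itv_bndo_bndc; last exact: integrable_heat_weight01.
move=> h; have {}h : log_ein (c + 4^-1 + n.+1%:R) - log_ein c @[n --> \oo] -->
    \int[mu]_(u in `]0, 1]) heat_weight 0 t u.
  rewrite -[X in X @ _ --> _](_ : (fun n => - log_ein (c / 1) -
    - log_ein (c / (c / (c + 4^-1 + n.+1%:R)))) = _); last first.
    apply/funext => n; rewrite divr1 opprK addrC; congr (log_ein _ - _).
    by rewrite invf_div mulrCA divff ?mulr1// gt_eqF.
  apply: h.
  - exact: integrable_heat_weight0c1.
  - move=> n; rewrite ltr_pdivrMr// mul1r -addrA ltrDl addr_gt0//.
  - move=> n x; rewrite /= !in_itv/= => /andP[h1 ->]; rewrite andbT.
    by apply: lt_le_trans h1; rewrite divr_gt0.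
  - move=> x /D0/andP[x0 x1]; near=> n; rewrite x1 andbT ler_pdivrMr//.
    rewrite mulrC -ler_pdivrMr//.
    rewrite (@le_trans _ _ n.+1%:R)//; last by rewrite lerDr addr_ge0// ltW.
    rewrite (@le_trans _ _ n%:R)// ?ler_nat//.
    by near: n; exact: nbhs_infty_ger.
  - move=> u /D0/andP[u0 _]; have un0 : u != 0 by rewrite gt_eqF.
    have cu0 : 0 < c / u by rewrite divr_gt0.
    have dg : is_derive u 1 (fun u => c / u) (- (c / u ^+ 2)).
      have := is_deriveZ c (is_deriveV un0 (is_derive_id u 1)).
      by move=> /is_derive_eq; apply; rewrite /GRing.scale/= mulr1 mulrN.
    have := is_deriveN (@is_derive1_comp _ log_ein (fun u => c / u) u _ _ (is_derive_log_ein cu0) dg).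
    move=> /is_derive_eq; apply.
    rewrite /heat_weight (_ : c / u = t ^+ 2 / (4 * u)); last by rewrite /c invfM mulrA.
    rewrite /GRing.scale/= /c; field; rewrite un0/=.
    by rewrite gt_eqF.
  - by move=> u /D0/andP[u0 _]; exact: continuous_heat_weight.
rewrite -(cvg_lim _ h)//; apply/cvg_lim => //.
by apply: cvgB => //; exact: cvg_cst.
Unshelve. all: by end_near. Qed.

(** Since ln(t^2/4) = 2 ln t + ln(1/4), the logarithm of 1/4 cancels the one in [log_ein] at 1/4,
    and Ein(t^2/4) tends to 0. *)
Lemma cvg_Rintegral_heat_weight01 :
  \int[mu]_(u in `]0, 1[) heat_weight 0 t u + 2 * ln t @[t --> (0 : R)^'+] -->
  \int[mu]_(v in `](4^-1 : R), +oo[) (expR (- v) / v)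
    - \int[mu]_(v in `]0, (4^-1 : R)[) ((1 - expR (- v)) / v).
Proof.
have e4 : \int[mu]_(v in `]0, (4^-1 : R)[) ((1 - expR (- v)) / v) = ein 4^-1.
  rewrite Rintegral_itv_bndo_bndc//.
  apply: integrableS (integrable_ein_integrand 4^-1) => //.
  by apply: subset_itv; rewrite bnd_simp.
rewrite e4 -[X in _ --> X]addr0.
have : \int[mu]_(v in `](4^-1 : R), +oo[) (expR (- v) / v) - ein 4^-1 + ein (t ^+ 2 / 4)
    @[t --> (0 : R)^'+] --> \int[mu]_(v in `](4^-1 : R), +oo[) (expR (- v) / v) - ein 4^-1 + 0.
  apply: cvgD; first exact: cvg_cst.
  have /cvg_at_rightP h := cvg_ein_at_right.
  apply/cvg_at_rightP => s [s0 cs]; apply: h; split.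
    by move=> n; rewrite divr_gt0// exprn_gt0.
  rewrite -[X in _ --> X](_ : 0 ^+ 2 / 4 = 0); last by rewrite expr0n mul0r.
  by apply: cvgMl; rewrite expr2; under eq_cvg do rewrite expr2; exact: cvgM.
apply: cvg_trans; apply: near_eq_cvg; near=> t.
have t0 : 0 < t by near: t; exact: nbhs_right_gt.
rewrite Rintegral_heat_weight01// /log_ein.
have -> : ln (t ^+ 2 / 4) = 2 * ln t + ln 4^-1.
  by rewrite lnM ?posrE ?exprn_gt0 ?invr_gt0// lnXn// mulr_natl.
by ring.
Unshelve. all: by end_near. Qed.

End ExponentialIntegral.

(** * The extension problem *)

Section HeatEquation.
Variable R : realType.
Local Notation mu := (@lebesgue_measure R).
Implicit Types (t u : R) (m n : int) (k : nat).

Lemma is_derive_heat_kernel m u :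
  is_derive u 1 (fun u => heat_kernel u m)
    (heat_kernel u (m + 1) + heat_kernel u (m - 1) - 2 * heat_kernel u m).
Proof.
rewrite (_ : (fun u => _) = heat_nat `|m|%N); last first.
  by apply/funext => v; rewrite heat_kernelE.
rewrite !heat_kernelE; case: m => [[|k]|k].
- apply: (is_derive_eq (is_derive_heat_nat0 u)); rewrite /=; ring.
- rewrite (_ : Posz k.+1 - 1 = Posz k); last by rewrite -addn1 PoszD addrK.
  have -> : Posz k.+1 + 1 = Posz k.+2 by rewrite -PoszD addn1.
  exact: is_derive_heat_natS.
- rewrite (_ : Negz k + 1 = - Posz k); last by rewrite NegzE -addn1 PoszD opprD addrNK.
  rewrite (_ : Negz k - 1 = Negz k.+1); last by rewrite !NegzE -[k.+2]addn1 PoszD opprD.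
  rewrite abszN /=; apply: (is_derive_eq (is_derive_heat_natS k u)).
  by rewrite [heat_nat k u + _]addrC.
Qed.

Lemma heat_kernel_decay0 m u : 0 < u ->
  `|heat_kernel u m| <= 4 * Num.sqrt (int_weight R m) * decay u.
Proof.
move=> u0; rewrite ger0_norm ?heat_kernel_ge0 ?(ltW u0)//.
have := heat_kernel_decay m 0 u0.
by rewrite subr0 /int_weight/= sqrtr1 divr1.
Qed.

Lemma heat_const_ge0 m : 0 <= 4 * Num.sqrt (int_weight R m).
Proof. by rewrite mulr_ge0// sqrtr_ge0. Qed.

Definition kernel_extension k m t : R := weighted_integral (fun u => heat_kernel u m) k t.

Lemma integrable_kernel_extension k m t : 0 < t ->
  mu.-integrable `]0, +oo[ (EFin \o (fun u => heat_kernel u m * heat_weight k t u)).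
Proof.
move=> t0; apply: (integrable_weighted_integrand _ (heat_const_ge0 m)) => //.
  exact: measurable_heat_kernel.
by move=> u; exact: heat_kernel_decay0.
Qed.

(** The u-derivative of p_u(m) [heat_weight 0 t u] integrates to zero. Near 0 the product is O(u)
    for fixed t, and at infinity it is at most 1/u. The left side comes from the weight, the right
    side from the heat equation. *)
Lemma kernel_extension_eq m t : 0 < t ->
  t ^+ 2 / 4 * kernel_extension 2 m t - kernel_extension 1 m t =
  - (kernel_extension 0 (m + 1) t + kernel_extension 0 (m - 1) t
     - 2 * kernel_extension 0 m t).
Proof.
move=> t0.
pose p j u := heat_kernel u j.
have i k j := integrable_kernel_extension k j t0.
have mD : measurable (`]0, +oo[%classic : set R) by [].
have iA := integrable_sub (integrable_mulr (t ^+ 2 / 4) (i 2%N m) mD) (i 1%N m) mD.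
have iB := integrable_sub (integrable_add (i 0 (m + 1)) (i 0 (m - 1)) mD)
  (integrable_mulr 2 (i 0 m) mD) mD.
have iAB := integrable_add iA iB mD.
pose h u := heat_kernel u m * heat_weight 0 t u.
have hD u : 0 < u -> is_derive u 1 h
    ((t ^+ 2 / 4 * (heat_kernel u m * heat_weight 2 t u) - heat_kernel u m * heat_weight 1 t u)
    + (heat_kernel u (m + 1) * heat_weight 0 t u + heat_kernel u (m - 1) * heat_weight 0 t u
       - 2 * (heat_kernel u m * heat_weight 0 t u))).
  move=> u0; apply: (is_derive_eq (is_deriveM (is_derive_heat_kernel m u) (is_derive_heat_weight0 t u0))).
  by rewrite /GRing.scale/=; ring.
have cp j u : {for u, continuous (p j)}.
  apply: differentiable_continuous; apply/derivable1_diffP.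
  exact: (@ex_derive _ _ _ _ _ _ _ (is_derive_heat_kernel j u)).
have cpw k j u : 0 < u -> {for u, continuous (fun u => heat_kernel u j * heat_weight k t u)}.
  by move=> u0; apply: cvgM; [exact: cp|exact: continuous_heat_weight].
have cD u : 0 < u -> {for u, continuous (fun u =>
    ((t ^+ 2 / 4 * (heat_kernel u m * heat_weight 2 t u) - heat_kernel u m * heat_weight 1 t u)
    + (heat_kernel u (m + 1) * heat_weight 0 t u + heat_kernel u (m - 1) * heat_weight 0 t u
       - 2 * (heat_kernel u m * heat_weight 0 t u))))}.
  move=> u0; apply: cvgD.
    by apply: cvgB; [apply: cvgMr|]; exact: cpw.
  by apply: cvgB; [apply: cvgD|apply: cvgMr]; exact: cpw.
have hle u : 0 < u -> 0 <= h u <= heat_weight 0 t u.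
  move=> u0; have w0 := heat_weight_ge0 0 t u0; have p0 := heat_kernel_ge0 m (ltW u0).
  by rewrite mulr_ge0//= ler_piMl// heat_kernel_le1// ltW.
have h0 : h u @[u --> (0 : R)^'+] --> (0 : R).
  apply: (@squeeze_cvgr _ _ _ _ (fun=> 0) (fun u => u * (2`!%:R * (4 / t ^+ 2) ^+ 2))).
  - near=> u; have u0 : 0 < u by near: u; exact: nbhs_right_gt.
    have /andP[-> /le_trans] := hle u u0; apply.
    rewrite -ler_pdivrMl// mulrC /heat_weight expr1 -mulrA -expr2 exprVn.
    exact: expR_div_exprn_le.
  - exact: cvg_cst.
  - rewrite -[X in _ --> X](mul0r (2`!%:R * (4 / t ^+ 2) ^+ 2)); apply: cvgMl.
    by apply: cvg_at_right_filter; exact: cvg_id.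
have hy : h u @[u --> +oo] --> (0 : R).
  apply/cvgrPdist_le => e e0; near=> u.
  have u0 : 0 < u by near: u; apply: nbhs_pinfty_gt; rewrite num_real.
  have ue : e^-1 <= u by near: u; apply: nbhs_pinfty_ge; rewrite num_real.
  have /andP[hu0 huw] := hle u u0.
  rewrite sub0r normrN (ger0_norm hu0) (le_trans huw)//.
  rewrite (@le_trans _ _ u^-1)//.
    rewrite -[leRHS]mul1r /heat_weight expr1 ler_wpM2r ?invr_ge0 ?(ltW u0)//.
    exact: gauss_factor_le1.
  by rewrite -[leRHS]invrK lef_pV2 ?posrE ?invr_gt0.
have := Rintegral_FTC_oy iAB hD cD h0 hy.
rewrite subr0 RintegralD// RintegralB//; last exact: integrable_mulr.
rewrite RintegralB//; [|exact: integrable_add|exact: integrable_mulr].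
rewrite RintegralD// !RintegralZl// => /eqP; rewrite addr_eq0 => /eqP.
exact.
Unshelve. all: by end_near. Qed.

End HeatEquation.

(** * From the kernel to a general sequence f *)

Section Extension.
Variables (R : realType) (f : int -> R).
Hypothesis hf : weighted_summable f.
Local Notation mu := (@lebesgue_measure R).
Implicit Types (t u : R) (m n : int) (k : nat).

Local Notation F n := (fun u => heat_semigroup u f n).

Let U0 (u : R) : `]0, +oo[%classic u -> 0 < u.
Proof. by rewrite /= in_itv/= andbT. Qed.

Lemma measurable_heat_semigroup n : measurable_fun (`]0, +oo[%classic : set R) (F n).
Proof.
apply: measurable_zsum => // [m|u /U0 u0]; last exact: zsummable_heat_semigroup.
by apply: measurable_funM => //; exact: measurable_heat_kernel.
Qed.

(** Moves the sum over m outside the u-integral, so that identities for a single kernel transfer to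
    f. *)
Lemma weighted_integral_zsum n k t : 0 < t ->
  zsummable (fun m => f m * kernel_extension k (n - m) t) /\
  weighted_integral (F n) k t = zsum [set: int] (fun m => f m * kernel_extension k (n - m) t).
Proof.
move=> t0; have [M M0 hM] := heat_weight_le k t0.
pose h m u := heat_kernel u (n - m) * f m * heat_weight k t u.
pose b m := 4 * Num.sqrt (int_weight R n) * M * (`|f m| / Num.sqrt (int_weight R m)).
have mh m : measurable_fun (`]0, +oo[%classic : set R) (h m).
  apply: measurable_funM; last exact: measurable_heat_weight.
  by apply: measurable_funM => //; exact: measurable_heat_kernel.
have sb : zsummable b by exact/zsummableZ/zsummable_weighted.
have hb m u : `]0, +oo[%classic u -> `|h m u| <= b m * dominator u.
  move=> /U0 u0; rewrite normrM (ger0_norm (heat_weight_ge0 _ _ u0)).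
  have -> : b m * dominator u = (4 * Num.sqrt (int_weight R n) *
     (`|f m| / Num.sqrt (int_weight R m)) * decay u) * (M / (1 + u)).
    by rewrite /b /dominator; ring.
  apply: ler_pM; [by []|exact: heat_weight_ge0|exact: heat_summand_decay|exact: hM].
have mD : measurable (`]0, +oo[%classic : set R) by [].
have e m : \int[mu]_(u in `]0, +oo[) h m u = f m * kernel_extension k (n - m) t.
  rewrite /kernel_extension /weighted_integral -RintegralZl//; last exact: integrable_kernel_extension.
  by apply: eq_Rintegral => u _; rewrite /h; ring.
have ee : (fun m => f m * kernel_extension k (n - m) t) =
    (fun m => \int[mu]_(u in `]0, +oo[) h m u) by apply/funext => m; rewrite e.
rewrite ee; split.
  exact: (@zsummable_Rintegral _ _ R mu _ mD h b (@dominator R) mh sb (integrable_dominator R) hb).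
rewrite -(@integrable_Rintegral_zsum _ _ R mu _ mD h b (@dominator R) mh sb (integrable_dominator R) hb).2.
apply: eq_Rintegral => u; rewrite inE => /U0 u0.
rewrite /heat_semigroup mulrC -zsumZ; last exact: zsummable_heat_semigroup.
by congr zsum; apply/funext => m; rewrite /h mulrC.
Qed.

Lemma extensionE n t : extension f n t = weighted_integral (F n) 0 t.
Proof.
by apply: eq_Rintegral => u _; rewrite /extension_integrand /heat_weight expr1.
Qed.

Lemma is_derive_weighted_semigroup n k t : 0 < t ->
  is_derive t 1 (weighted_integral (F n) k) (- (t / 2) * weighted_integral (F n) k.+1 t).
Proof.
have [C C0 FC] := heat_semigroup_decay hf n.
exact: (is_derive_weighted_integral (measurable_heat_semigroup n) C0 FC).
Qed.

Lemma derive1_extension n t : 0 < t ->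
  derive1 (extension f n) t = - (t / 2) * weighted_integral (F n) 1 t.
Proof.
move=> t0; rewrite (_ : extension f n = weighted_integral (F n) 0); last first.
  by apply/funext => s; rewrite extensionE.
by rewrite derive1E; apply: derive_val; exact: is_derive_weighted_semigroup.
Qed.

Lemma is_derive_derive1_extension n t : 0 < t ->
  is_derive t 1 (derive1 (extension f n))
    (t ^+ 2 / 4 * weighted_integral (F n) 2 t - 2^-1 * weighted_integral (F n) 1 t).
Proof.
move=> t0.
have d1 := is_deriveM (is_deriveZ (- 2^-1) (is_derive_id t 1)) (is_derive_weighted_semigroup n 1 t0).
(* The formula for the first derivative holds for positive times only, so it is differentiated as an
   equality near t. *)
apply: near_eq_is_derive; last first.
  apply: (is_derive_eq d1).
  change ((- 2^-1 * t) * (- (t / 2) * weighted_integral (F n) 2 t)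
    + weighted_integral (F n) 1 t * (- 2^-1 * 1) =
    t ^+ 2 / 4 * weighted_integral (F n) 2 t - 2^-1 * weighted_integral (F n) 1 t).
  by field.
near=> s; rewrite derive1_extension; last by near: s; exact: lt_nbhsr.
change (- 2^-1 * s * weighted_integral (F n) 1 s = - (s / 2) * weighted_integral (F n) 1 s).
by congr (_ * _); rewrite mulNr mulrC.
Unshelve. all: by end_near. Qed.

(** The second derivative and (1/t) d/dt each contribute -W_1/2. Together with (t^2/4) W_2 they form
    the integral of F against the u-derivative of [heat_weight 0 t]. *)
Lemma extension_equation n t : 0 < t ->
  derive1 (derive1 (extension f n)) t + t^-1 * derive1 (extension f n) t
    + discrete_laplacian (fun k : int => extension f k t) n = 0.
Proof.
move=> t0.
have alg (a b c d g : R) : a - b = - (c + d - 2 * g) ->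
  a - 2^-1 * b + - 2^-1 * b + (c - 2 * g + d) = 0 by move=> h; lra.
have -> : derive1 (derive1 (extension f n)) t =
    t ^+ 2 / 4 * weighted_integral (F n) 2 t - 2^-1 * weighted_integral (F n) 1 t.
  by rewrite derive1E; apply: derive_val; exact: is_derive_derive1_extension.
rewrite derive1_extension// /discrete_laplacian !extensionE.
have [s2 e2] := weighted_integral_zsum n 2 t0.
have [s1 e1] := weighted_integral_zsum n 1 t0.
have [s0 e0] := weighted_integral_zsum n 0 t0.
have [sp ep] := weighted_integral_zsum (n + 1) 0 t0.
have [sm em] := weighted_integral_zsum (n - 1) 0 t0.
have key : t ^+ 2 / 4 * weighted_integral (F n) 2 t - weighted_integral (F n) 1 t =
   - (weighted_integral (F (n + 1)) 0 t + weighted_integral (F (n - 1)) 0 t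
     - 2 * weighted_integral (F n) 0 t).
  have sL := zsumD (zsummableZ (t ^+ 2 / 4) s2) (zsummableN s1).
  have sR0 := zsummableD (zsummableD sp sm) (zsummableN (zsummableZ 2 s0)).
  have sR := zsumD (zsummableD sp sm) (zsummableN (zsummableZ 2 s0)).
  rewrite (zsumZ _ s2) (zsumN s1) in sL.
  rewrite (zsumD sp sm) (zsumN (zsummableZ 2 s0)) (zsumZ _ s0) in sR.
  rewrite e2 e1 e0 ep em -sL -sR -(zsumN sR0).
  congr zsum; apply/funext => m.
  have := kernel_extension_eq (n - m) t0.
  rewrite (_ : n - m + 1 = n + 1 - m); last by rewrite addrAC.
  rewrite (_ : n - m - 1 = n - 1 - m); last by rewrite addrAC.
  move: (kernel_extension 2 _ _) (kernel_extension 1 _ _) (kernel_extension 0 (n + 1 - m) t)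
    (kernel_extension 0 (n - 1 - m) t) (kernel_extension 0 (n - m) t) (f m) (t ^+ 2 / 4).
  move=> a b c d g y z e; transitivity (y * (z * a - b)); first by ring.
  by rewrite e; ring.
have -> : t^-1 * (- (t / 2) * weighted_integral (F n) 1 t) =
    - 2^-1 * weighted_integral (F n) 1 t by field; rewrite gt_eqF.
exact: alg key.
Qed.

Let D1 (u : R) : `]0, 1[%classic u -> 0 < u < 1.
Proof. by rewrite /= in_itv. Qed.

Let D2 (u : R) : `]1, +oo[%classic u -> 1 < u.
Proof. by rewrite /= in_itv/= andbT. Qed.

Let invr_le2 u : 1 < u -> u^-1 <= 2 / (1 + u).
Proof.
move=> u1; have u0 : 0 < u by exact: lt_trans u1.
by rewrite ler_pdivlMr ?addr_gt0// mulrC ler_pdivrMr//; lra.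
Qed.

Let measurable_invr01 : measurable_fun (`]0, 1[%classic : set R) (fun u => u^-1 : R).
Proof.
apply: open_continuous_measurable_fun; first exact: interval_open.
move=> u; rewrite inE => /D1/andP[u0 _]; apply: cvgV; first by rewrite gt_eqF.
exact: cvg_id.
Qed.

Let measurable_invr1y : measurable_fun (`]1, +oo[%classic : set R) (fun u => u^-1 : R).
Proof.
apply: open_continuous_measurable_fun; first exact: interval_open.
move=> u; rewrite inE => /D2 u1; apply: cvgV; first by rewrite gt_eqF// (lt_trans _ u1).
exact: cvg_id.
Qed.

Let integrable_cst01 (r : R) : mu.-integrable `]0, 1[ (EFin \o (fun=> r)).
Proof.
apply: measurable_bounded_integrable => //; last exact: bounded_cst.
by rewrite /= lebesgue_measure_itv/=; case: ifP => _ //; rewrite -EFinD ltry.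
Qed.

Lemma zsummable_centered_summand n (u : R) : 0 <= u ->
  zsummable (fun m => heat_kernel u (n - m) * (f m - f n)).
Proof.
move=> u0; apply: (@zsummable_le R _ (fun m => u * centered_weight f n m)) => [m|].
  by rewrite [leRHS]mulrC; exact: heat_summand_small_time.
exact/zsummableZ/zsummable_centered_weight.
Qed.

(** On (0, 1) the bound O(u) on each centred summand cancels the factor 1/u, so the exchange of sum
    and integral has a constant as majorant in u. The sign reflects f(n) - f(m) against f(m) -
    f(n). *)
Lemma zsum_W0 n : zsum [set m | m != n] (fun m => W0 R (n - m) * (f n - f m)) =
  - \int[mu]_(u in `]0, 1[) ((F n u - f n) / u).
Proof.
rewrite (@zsum_mkcond _ n); last by rewrite [f n - f n]subrr mulr0.
pose h m u := heat_kernel u (n - m) * (f m - f n) * u^-1.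
have mh m : measurable_fun (`]0, 1[%classic : set R) (h m).
  apply: measurable_funM => //; apply: measurable_funM => //; exact: measurable_heat_kernel.
have sb := zsummable_centered_weight hf n.
have hb m u : `]0, 1[%classic u -> `|h m u| <= centered_weight f n m * 1.
  move=> /D1/andP[u0 _]; rewrite mulr1 normrM (ger0_norm (_ : 0 <= u^-1)); last first.
    by rewrite invr_ge0 ltW.
  by rewrite ler_pdivrMr//; apply: heat_summand_small_time; exact: ltW.
have mD : measurable (`]0, 1[%classic : set R) by [].
have e m : W0 R (n - m) * (f n - f m) = - \int[mu]_(u in `]0, 1[) h m u.
  (* At m = n the integral defining [W0] diverges; the factor f(n) - f(n) = 0 removes whatever value
     it is assigned. *)
  have [->|mn] := eqVneq m n.
    rewrite [f n - f n]subrr mulr0 (_ : \int[mu]_(u in _) _ = 0) ?oppr0//.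
    rewrite -[RHS](mul0r (fine (mu `]0, 1[))) -Rintegral_cst//.
    by apply: eq_Rintegral => u _; rewrite /h [f n - f n]subrr mulr0 mul0r.
  have ip : mu.-integrable `]0, 1[ (EFin \o (fun u => heat_kernel u (n - m) / u)).
    apply: (@integrable_le _ _ R mu _ _ (fun u => 8 * int_weight R n ^+ 2 / int_weight R m ^+ 2)) => //.
      by apply: measurable_funM => //; exact: measurable_heat_kernel.
    move=> u /D1/andP[u0 _]; rewrite ger0_norm; last first.
      by rewrite divr_ge0 ?heat_kernel_ge0 ?(ltW u0).
    by rewrite ler_pdivrMr//; apply: heat_kernel_small_time => //; exact: ltW.
  rewrite -[f n - f m]opprB mulrN /W0 -RintegralZr//; congr (- _).
  by apply: eq_Rintegral => u _; rewrite /h mulrAC.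
have -> : (fun m => W0 R (n - m) * (f n - f m)) =
    (fun m => - \int[mu]_(u in `]0, 1[) h m u) by apply/funext => m; rewrite e.
have s1 := @zsummable_Rintegral _ _ R mu _ mD h _ (fun=> 1) mh sb (integrable_cst01 1) hb.
rewrite zsumN//; congr (- _).
rewrite -(@integrable_Rintegral_zsum _ _ R mu _ mD h _ (fun=> 1) mh sb (integrable_cst01 1) hb).2.
apply: eq_Rintegral => u; rewrite inE => /D1/andP[u0 _].
rewrite heat_semigroup_center// mulrC -zsumZ; last exact/zsummable_centered_summand/ltW.
by congr zsum; apply/funext => m; rewrite /h mulrC.
Qed.

Lemma zsum_Winf n : zsum [set: int] (fun m => Winf R (n - m) * f m) =
  \int[mu]_(u in `]1, +oo[) (F n u / u).
Proof.
pose h m u := heat_kernel u (n - m) * f m * u^-1.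
have sD2 : `]1, +oo[ `<=` (`]0, +oo[%classic : set R) by apply: subset_itvr; rewrite bnd_simp.
have mh m : measurable_fun (`]1, +oo[%classic : set R) (h m).
  apply: measurable_funM => //; apply: measurable_funM => //; exact: measurable_heat_kernel.
pose b m := 4 * Num.sqrt (int_weight R n) * 2 * (`|f m| / Num.sqrt (int_weight R m)).
have sb : zsummable b by exact/zsummableZ/zsummable_weighted.
have mD : measurable (`]1, +oo[%classic : set R) by [].
have iw := integrable_oy_sub mD sD2 (integrable_dominator R).
have hb m u : `]1, +oo[%classic u -> `|h m u| <= b m * dominator u.
  move=> /D2 u1; have u0 : 0 < u by exact: lt_trans u1.
  have ui : 0 <= u^-1 by rewrite invr_ge0 ltW.
  rewrite normrM (ger0_norm ui).
  have -> : b m * dominator u = (4 * Num.sqrt (int_weight R n) *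
     (`|f m| / Num.sqrt (int_weight R m)) * decay u) * (2 / (1 + u)).
    by rewrite /b /dominator; ring.
  by apply: ler_pM => //; [exact: heat_summand_decay|exact: invr_le2].
have e m : Winf R (n - m) * f m = \int[mu]_(u in `]1, +oo[) h m u.
  have ip : mu.-integrable `]1, +oo[ (EFin \o (fun u => heat_kernel u (n - m) / u)).
    apply: (@integrable_le _ _ R mu _ _
      (fun u => 4 * Num.sqrt (int_weight R (n - m)) * 2 * dominator u)) => //.
    - by apply: measurable_funM => //; exact: measurable_heat_kernel.
    - move=> u /D2 u1; have u0 : 0 < u by exact: lt_trans u1.
      have ui : 0 <= u^-1 by rewrite invr_ge0 ltW.
      rewrite normrM (ger0_norm ui).
      have -> : 4 * Num.sqrt (int_weight R (n - m)) * 2 * dominator u =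
        4 * Num.sqrt (int_weight R (n - m)) * decay u * (2 / (1 + u)).
        by rewrite /dominator; ring.
      by apply: ler_pM => //; [exact: heat_kernel_decay0|exact: invr_le2].
    - exact: integrable_mulr.
  rewrite /Winf -RintegralZr//.
  by apply: eq_Rintegral => u _; rewrite /h mulrAC.
have -> : (fun m => Winf R (n - m) * f m) =
    (fun m => \int[mu]_(u in `]1, +oo[) h m u) by apply/funext => m; rewrite e.
rewrite -(@integrable_Rintegral_zsum _ _ R mu _ mD h b _ mh sb iw hb).2.
apply: eq_Rintegral => u; rewrite inE => /D2 u1; have u0 : 0 < u by exact: lt_trans u1.
rewrite /heat_semigroup mulrC -zsumZ; last exact: zsummable_heat_semigroup.
by congr zsum; apply/funext => m; rewrite /h mulrC.
Qed.

Lemma integrable_extension n t : 0 < t ->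
  mu.-integrable `]0, +oo[ (fun u => (extension_integrand f n t u)%:E).
Proof.
move=> t0; have [C C0 FC] := heat_semigroup_decay hf n.
apply: (eq_integrable_fun _ (integrable_weighted_integrand (measurable_heat_semigroup n) C0 FC 0 t0)) => //.
Qed.

Lemma cvg_extension_pinfty n : extension f n t @[t --> +oo] --> (0 : R).
Proof.
have [C C0 FC] := heat_semigroup_decay hf n.
under eq_cvg do rewrite extensionE.
exact: (cvg_weighted_integral_pinfty (measurable_heat_semigroup n) C0 FC).
Qed.

Lemma cvg_mul_derive1_extension n :
  t * derive1 (extension f n) t @[t --> (0 : R)^'+] --> - 2 * f n.
Proof.
have [C C0 FC] := heat_semigroup_decay hf n.
have [C1 C10 FC1] := heat_semigroup_small_time hf n.
have := @cvg_weighted_integral1 R (F n) C C1 (f n) (measurable_heat_semigroup n) C0 FC C10 FC1.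
(* From the first derivative, t d/dt u_f = -(t^2/2) W_1, which is -2 times the averaged quantity
   (t^2/4) W_1. *)
move=> h; have h2 : - 2 * (t ^+ 2 / 4 * weighted_integral (F n) 1 t)
    @[t --> (0 : R)^'+] --> - 2 * f n by apply: cvgMr; exact: h.
apply: cvg_trans h2; apply: near_eq_cvg; near=> t.
rewrite derive1_extension; last by near: t; exact: nbhs_right_gt.
by field.
Unshelve. all: by end_near. Qed.

(** The integral of the weight over (0, 1), subtracted to obtain a finite limit, is added back
    together with 2 ln t, a sum that converges. *)
Lemma cvg_extension_log n : extension f n t + 2 * f n * ln t @[t --> (0 : R)^'+] -->
  \int[mu]_(u in `]0, 1[) ((F n u - f n) / u) + \int[mu]_(u in `]1, +oo[) (F n u / u)
  + f n * (\int[mu]_(v in `](4^-1 : R), +oo[) (expR (- v) / v)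
    - \int[mu]_(v in `]0, (4^-1 : R)[) ((1 - expR (- v)) / v)).
Proof.
have [C C0 FC] := heat_semigroup_decay hf n.
have [C1 C10 FC1] := heat_semigroup_small_time hf n.
have [_ _ h] := @cvg_weighted_integral0 R (F n) C C1 (f n) (measurable_heat_semigroup n) C0 FC FC1.
have h2 : f n * (\int[mu]_(u in `]0, 1[) heat_weight 0 t u + 2 * ln t)
    @[t --> (0 : R)^'+] -->
  f n * (\int[mu]_(v in `](4^-1 : R), +oo[) (expR (- v) / v)
    - \int[mu]_(v in `]0, (4^-1 : R)[) ((1 - expR (- v)) / v)).
  by apply: cvgMr; exact: cvg_Rintegral_heat_weight01.
have h3 : (weighted_integral (F n) 0 t - f n * \int[mu]_(u in `]0, 1[) heat_weight 0 t u)
    + f n * (\int[mu]_(u in `]0, 1[) heat_weight 0 t u + 2 * ln t)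
    @[t --> (0 : R)^'+] -->
  \int[mu]_(u in `]0, 1[) ((F n u - f n) / u) + \int[mu]_(u in `]1, +oo[) (F n u / u)
  + f n * (\int[mu]_(v in `](4^-1 : R), +oo[) (expR (- v) / v)
    - \int[mu]_(v in `]0, (4^-1 : R)[) ((1 - expR (- v)) / v)).
  by apply: cvgD; [exact: h|exact: h2].
apply: cvg_trans h3; apply: near_eq_cvg; apply: nearW => t.
by rewrite extensionE; ring.
Qed.

(** The logarithmically corrected extension has a finite limit, and 1/ln t tends to 0, so only the
    correction survives division. *)
Lemma cvg_extension_div_log n : extension f n t / ln t @[t --> (0 : R)^'+] --> - 2 * f n.
Proof.
have lneg : \forall t \near (0 : R)^'+, ln t < 0 :> R.
  near=> t; apply: ln_lt0; apply/andP; split; near: t; first exact: nbhs_right_gt.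
  exact: nbhs_right_lt.
have linv : (ln t)^-1 @[t --> (0 : R)^'+] --> (0 : R).
  by apply/(ltr0_cvgV0 lneg); exact: lnNy.
have h := @cvg_extension_log n; set L := (X in _ --> X) in h.
have h2 : (extension f n t + 2 * f n * ln t) / ln t - 2 * f n
    @[t --> (0 : R)^'+] --> L * 0 - 2 * f n.
  by apply: cvgB; [apply: cvgM; [exact: h|exact: linv]|exact: cvg_cst].
rewrite -[X in _ --> X](_ : L * 0 - 2 * f n = _); last by rewrite mulr0 sub0r mulNr.
apply: cvg_trans h2; apply: near_eq_cvg; near=> t.
have l0 : ln t < 0 by near: t; exact: lneg.
by field; rewrite lt_eqF.
Unshelve. all: by end_near. Qed.

End Extension.

Theorem theorem1p2 (R : realType) (f : int -> R) (hf : weighted_summable f) :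
  (* the sum and the integral defining u_f converge absolutely *)
  ((forall (n : int) (u : R), 0 < u ->
      summable [set: int] (fun m => (heat_kernel u (n - m) * f m)%:E)) /\
   (forall (n : int) (t : R), 0 < t ->
      (@lebesgue_measure R).-integrable `]0, +oo[
        (fun u => (extension_integrand f n t u)%:E))) /\
  (* (i) *)
  (forall n : int, extension f n t @[t --> +oo] --> (0 : R)) /\
  (* (ii) *)
  (forall (n : int) (t : R), 0 < t ->
     derivable (extension f n) t 1 /\
     derivable (derive1 (extension f n)) t 1 /\
     derive1 (derive1 (extension f n)) t + t^-1 * derive1 (extension f n) t
       + discrete_laplacian (fun k => extension f k t) n = 0) /\
  (* (iii) *)
  (forall n : int,
     t * derive1 (extension f n) t @[t --> (0 : R)^'+] --> - 2 * f n) /\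
  (* (iv) *)
  (forall n : int,
     extension f n t / ln t @[t --> (0 : R)^'+] --> - 2 * f n) /\
  (* (v) *)
  (forall n : int,
     cvg (extension f n t + 2 * f n * ln t @[t --> (0 : R)^'+]) /\
     log_laplacian f n =
       - lim (extension f n t + 2 * f n * ln t @[t --> (0 : R)^'+])
       + f n * constK).
Proof.
split; [split|split; [|split; [|split; [|split]]]].
- by move=> n u u0; exact: zsummable_heat_semigroup.
- exact: integrable_extension.
- exact: cvg_extension_pinfty.
- move=> n t t0; split; [|split].
  + rewrite (_ : extension f n = weighted_integral (fun u => heat_semigroup u f n) 0); last first.
      by apply/funext => s; rewrite extensionE.
    exact: (@ex_derive _ _ _ _ _ _ _ (is_derive_weighted_semigroup hf n 0 t0)).
  + exact: (@ex_derive _ _ _ _ _ _ _ (is_derive_derive1_extension hf n t0)).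
  + exact: extension_equation.
- exact: cvg_mul_derive1_extension.
- exact: cvg_extension_div_log.
- move=> n; have c := @cvg_extension_log R f hf n; split.
    by apply/cvg_ex; eexists; exact: c.
  by rewrite (cvg_lim _ c)// /log_laplacian (zsum_W0 hf) (zsum_Winf hf) /constK; ring.
Qed.
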